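(* Let $\mathfrak{n}$ be an $n$-dimensional real vector space, $V=\Lambda^2\mathfrak{n}^*\otimes\mathfrak{n}$, let $\gamma$ be a tensor (or set of tensors) on $\mathfrak{n}$ of one of the classes considered, and fix an inner product $\langle\cdot,\cdot\rangle$ on $\mathfrak{n}$ compatible with $\gamma$. Let $F:\mathbb{P}V\to\mathbb{R}$ be defined by $F([\mu])=\mathrm{tr}(\mathrm{Ric}^\gamma_\mu)^2/\|\mu\|^4$. Then for $0\neq\mu\in V$ the following conditions are equivalent: (i) $[\mu]$ is a critical point of $F$. (ii) The restriction $F|_{G_\gamma.[\mu]}$ attains its minimum value at $[\mu]$. (iii) $\mathrm{Ric}^\gamma_\mu=cI+D$ for some $c\in\mathbb{R}$ and $D\in\mathrm{Der}(\mu)$. Moreover, all the other critical points of $F$ in the orbit $G_\gamma.[\mu]$ lie in $K_\gamma.[\mu]$.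
   Context: $V=\Lambda^2\mathfrak{n}^*\otimes\mathfrak{n}$ is the space of all skew-symmetric bilinear maps $\mathfrak{n}\times\mathfrak{n}\to\mathfrak{n}$, and $\mathbb{P}V$ its projective space of lines. $\mathrm{GL}(n)=\mathrm{GL}(\mathfrak{n})$ acts on $V$ by $g.\mu(X,Y)=g\mu(g^{-1}X,g^{-1}Y)$, and hence on $\mathbb{P}V$. $V$ carries the inner product $\langle\mu,\lambda\rangle=\sum_{ijk}\langle\mu(X_i,X_j),X_k\rangle\langle\lambda(X_i,X_j),X_k\rangle$, $\{X_i\}$ any orthonormal basis of $\mathfrak{n}$, with norm $\|\cdot\|$. $\mathrm{Der}(\mu)=\{D\in\mathfrak{gl}(\mathfrak{n}):D\mu(X,Y)=\mu(DX,Y)+\mu(X,DY)\ \forall X,Y\}$. $G_\gamma=\{\varphi\in\mathrm{GL}(n):\varphi.\gamma=\gamma\}$ with Lie algebra $\mathfrak{g}_\gamma$, and $K_\gamma=G_\gamma\cap\mathrm{O}(\mathfrak{n},\langle\cdot,\cdot\rangle)$. Standing facts/assumptions: $G_\gamma$ is (real algebraic) reductive, $K_\gamma$ is a maximal compact subgroup with Lie algebra $\mathfrak{k}_\gamma$, and $\mathfrak{g}_\gamma=\mathfrak{k}_\gamma\oplus\mathfrak{p}_\gamma$ is a Cartan decomposition, where $\mathfrak{p}_\gamma$ is the space of symmetric (with respect to $\langle\cdot,\cdot\rangle$) elements of $\mathfrak{g}_\gamma$. The classes in mind are: (almost-)symplectic ($\gamma=\omega$ a non-degenerate 2-form; compatible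 means that $J$ defined by $\omega(X,Y)=\langle X,JY\rangle$ satisfies $J^2=-I$; $G_\gamma=\mathrm{Sp}(n/2,\mathbb{R})$, $K_\gamma=\mathrm{U}(n/2)$); (almost-)complex ($\gamma=J$, $J^2=-I$; compatible means $J$ orthogonal; $G_\gamma=\mathrm{GL}(n/2,\mathbb{C})$, $K_\gamma=\mathrm{U}(n/2)$); (almost-)hypercomplex ($\gamma=\{J_1,J_2,J_3\}$, $J_i^2=-I$, $J_1J_2=J_3=-J_2J_1$; compatible means all $J_i$ orthogonal; $G_\gamma=\mathrm{GL}(n/4,\mathbb{H})$, $K_\gamma=\mathrm{Sp}(n/4)$); and $\gamma=0$ ($G_\gamma=\mathrm{GL}(n,\mathbb{R})$, $K_\gamma=\mathrm{O}(n)$). For $\mu\in V$, $\mathrm{Ric}_\mu$ denotes the symmetric map of $(\mathfrak{n},\langle\cdot,\cdot\rangle)$ given by $$\langle\mathrm{Ric}_\mu X,Y\rangle=-\tfrac12\sum_{ij}\langle\mu(X,X_i),X_j\rangle\langle\mu(Y,X_i),X_j\rangle+\tfrac14\sum_{ij}\langle\mu(X_i,X_j),X\rangle\langle\mu(X_i,X_j),Y\rangle$$ (when $\mu$ is a nilpotent Lie bracket this is the Ricci operator of the left invariant metric defined by $\langle\cdot,\cdot\rangle$ on the simply connected Lie group with Lie algebra $(\mathfrak{n},\mu)$), and $\mathrm{Ric}^\gamma_\mu$ is its orthogonal projection onto $\mathfrak{p}_\gamma$ with respect to the inner product $\mathrm{tr}(AB)$ on symmetric maps. *)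

(* Defs.v *)
From HB Require Import structures.
From mathcomp Require Import all_boot all_order all_algebra.
From mathcomp Require Import all_classical all_reals all_analysis.
From mathcomp Require Import ring.

Set Implicit Arguments.
Unset Strict Implicit.
Unset Printing Implicit Defensive.

Import Order.TTheory GRing.Theory Num.Theory.
Import numFieldNormedType.Exports.

Local Open Scope ring_scope.

(* Bilinear maps E x E -> E are curried: [mu X Y] with mu : bilin E; the space
   V of the skew-symmetric ones is the predicate [skew_bilin]. *)
Notation bilin E := 'Hom(E, 'End(E)).

Section Bilinear.
Variables (R : realType) (E : vectType R).

Definition skew_bilin (mu : bilin E) : Prop :=
  forall X Y, mu X Y = - mu Y X.

Definition is_derivation (mu : bilin E) (D : 'End(E)) : Prop :=
  forall X Y, D (mu X Y) = mu (D X) Y + mu X (D Y).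

Definition invertible (g : 'End(E)) : Prop := lker g = 0%VS.

(* For invertible g, g^-1%VF is the two-sided inverse of g. *)
Definition act (g : 'End(E)) (mu : bilin E) : bilin E :=
  linfun (fun X : E => (g \o mu ((g^-1)%VF X) \o g^-1)%VF).

Lemma actE (g : 'End(E)) (mu : bilin E) (X Y : E) :
  act g mu X Y = g (mu ((g^-1)%VF X) ((g^-1)%VF Y)).
Proof.
pose f := fun X : E => (g \o mu ((g^-1)%VF X) \o g^-1)%VF.
have lf : linear f.
  move=> a u v; apply/lfunP => z.
  by rewrite /f !(lfunE, comp_lfunE, linearP, scale_lfunE) /=
    !(add_lfunE, scale_lfunE, comp_lfunE, linearP).
pose fL : {linear E -> 'End(E)} :=
  HB.pack f (@GRing.isLinear.Build _ _ _ _ f lf).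
by rewrite /act -[linfun _]/(linfun fL) lfunE /= /f !comp_lfunE.
Qed.

End Bilinear.

(* The tensor(s) gamma, as raw data; see [class_tensors] for the conditions
   defining the classes. *)
Inductive tensors (R : realType) (E : vectType R) : Type :=
| NoTensor
| TwoForm of {skew_symmetric E}
| Endo of 'End(E)
| EndoTriple of 'End(E) & 'End(E) & 'End(E).

Arguments NoTensor {R E}.

Section Structures.
Variables (R : realType) (E : vectType R) (ip : {dot E for idfun}).

Definition almost_complex (J : 'End(E)) : Prop := (J \o J)%VF = - \1%VF.

Definition class_tensors (gamma : tensors E) : Prop :=
  match gamma with
  | NoTensor => True
  | TwoForm omega => nondegenerate omega
  | Endo J => almost_complex J
  | EndoTriple J1 J2 J3 =>
      [/\ almost_complex J1, almost_complex J2, almost_complex J3,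
          (J1 \o J2)%VF = J3 & (J2 \o J1)%VF = - J3]
  end.

Definition orthogonal_map (g : 'End(E)) : Prop :=
  forall X Y, ip (g X) (g Y) = ip X Y.

Definition symmetric_map (A : 'End(E)) : Prop :=
  forall X Y, ip (A X) Y = ip X (A Y).

Definition compatible (gamma : tensors E) : Prop :=
  match gamma with
  | NoTensor => True
  | TwoForm omega =>
      exists J : 'End(E),
        (forall X Y, omega X Y = ip X (J Y)) /\ almost_complex J
  | Endo J => orthogonal_map J
  | EndoTriple J1 J2 J3 =>
      [/\ orthogonal_map J1, orthogonal_map J2 & orthogonal_map J3]
  end.

(* phi.gamma = gamma; a set of tensors is fixed elementwise. *)
Definition fixes (phi : 'End(E)) (gamma : tensors E) : Prop :=
  let fix_endo J := (phi \o J \o phi^-1)%VF = J in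
  match gamma with
  | NoTensor => True
  | TwoForm omega =>
      forall X Y, omega ((phi^-1)%VF X) ((phi^-1)%VF Y) = omega X Y
  | Endo J => fix_endo J
  | EndoTriple J1 J2 J3 => [/\ fix_endo J1, fix_endo J2 & fix_endo J3]
  end.

Definition G_ (gamma : tensors E) (phi : 'End(E)) : Prop :=
  invertible phi /\ fixes phi gamma.

Definition K_ (gamma : tensors E) (phi : 'End(E)) : Prop :=
  G_ gamma phi /\ orthogonal_map phi.

(* A belongs to the Lie algebra of the closed subgroup G_ gamma iff it is the
   velocity at 0 of a one-parameter subgroup (necessarily exp(tA)) of it.
   E being finite dimensional, curves in 'End(E) are differentiated through
   their coefficients <c(t) X, Y>. *)
Definition lie_ (gamma : tensors E) (A : 'End(E)) : Prop :=
  exists c : R -> 'End(E),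
    [/\ forall t, G_ gamma (c t),
        forall s t, c (s + t) = (c s \o c t)%VF &
        forall X Y,
          is_derive (0 : R) (1 : R) (fun t : R => ip (c t X) Y) (ip (A X) Y)].

Definition p_ (gamma : tensors E) (A : 'End(E)) : Prop :=
  lie_ gamma A /\ symmetric_map A.

End Structures.

Section Functional.
Variables (R : realType) (E : vectType R) (ip : {dot E for idfun}).
Variables (n : nat) (e : n.-tuple E).

Definition orthonormal_basis : Prop :=
  basis_of {:E} e /\ orthonormal ip e.

Definition ip_bilin (mu la : bilin E) : R :=
  \sum_(i < n) \sum_(j < n) \sum_(k < n)
    ip (mu e`_i e`_j) e`_k * ip (la e`_i e`_j) e`_k.

Definition norm_bilin (mu : bilin E) : R := Num.sqrt (ip_bilin mu mu).

Definition trace (A : 'End(E)) : R := \sum_(i < n) ip (A e`_i) e`_i.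

Definition ric_form (mu : bilin E) (X Y : E) : R :=
  - (1 / 2) * (\sum_(i < n) \sum_(j < n)
                ip (mu X e`_i) e`_j * ip (mu Y e`_i) e`_j)
  + (1 / 4) * (\sum_(i < n) \sum_(j < n)
                ip (mu e`_i e`_j) X * ip (mu e`_i e`_j) Y).

(* The operator representing [ric_form mu]; see [RicE]. *)
Definition Ric (mu : bilin E) : 'End(E) :=
  linfun (fun X : E => \sum_(k < n) ric_form mu X e`_k *: e`_k).

(* The orthogonal projection of S onto p_ gamma for the inner product
   tr(AB): the P in p_ gamma with S - P orthogonal to p_ gamma. *)
Definition proj_p (gamma : tensors E) (S : 'End(E)) : 'End(E) :=
  xget 0 [set P : 'End(E) | p_ ip gamma P /\
    forall A, p_ ip gamma A -> trace ((S - P) \o A)%VF = 0]%classic.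

Definition Ric_ (gamma : tensors E) (mu : bilin E) : 'End(E) :=
  proj_p gamma (Ric mu).

(* F as a function of points of the projective space, i.e. of lines L, computed
   on a nonzero representative of L (the quotient is invariant under
   scaling). *)
Definition F_ (gamma : tensors E) (L : {vspace (bilin E)}) : R :=
  let mu := vpick L in
  trace (Ric_ gamma mu \o Ric_ gamma mu)%VF / norm_bilin mu ^+ 4.

Lemma ip_basis (u v : E) : basis_of {:E} e ->
  (forall k : 'I_n, ip u e`_k = ip v e`_k) -> u = v.
Proof.
move=> be H; apply/eqP; rewrite -subr_eq0; apply/negPn/negP => nz.
have := neq0_dnorm_gt0 (s := ip) _ nz.
rewrite [X in ip _ X](coord_basis be (memvf (u - v))) linear_sum /=.
rewrite big1 ?ltxx // => i _; rewrite linearZ /= linearBl /= H subrr.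
by rewrite mulr0.
Qed.

Lemma ric_form_linear mu Y : linear (ric_form mu ^~ Y).
Proof.
move=> a u v; rewrite /ric_form; set A := \sum_i _; set B := \sum_i _.
have -> : A = a * (\sum_(i < n) \sum_(j < n)
                ip (mu u e`_i) e`_j * ip (mu Y e`_i) e`_j)
            + \sum_(i < n) \sum_(j < n)
                ip (mu v e`_i) e`_j * ip (mu Y e`_i) e`_j.
  rewrite /A big_distrr -big_split; apply: eq_bigr => i _ /=.
  rewrite big_distrr -big_split; apply: eq_bigr => j _ /=.
  rewrite linearP add_lfunE scale_lfunE linearDl linearZl_LR /=.
  by rewrite mulrDl mulrA.
have -> : B = a * (\sum_(i < n) \sum_(j < n)
                ip (mu e`_i e`_j) u * ip (mu e`_i e`_j) Y)
            + \sum_(i < n) \sum_(j < n)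
                ip (mu e`_i e`_j) v * ip (mu e`_i e`_j) Y.
  rewrite /B big_distrr -big_split; apply: eq_bigr => i _ /=.
  rewrite big_distrr -big_split; apply: eq_bigr => j _ /=.
  rewrite linearDr linearZr_LR /=.
  by rewrite mulrDl mulrA.
by rewrite /GRing.scale /=; ring.
Qed.

Lemma ric_formC mu X Y : ric_form mu X Y = ric_form mu Y X.
Proof.
rewrite /ric_form; congr (_ * _ + _ * _); apply: eq_bigr => i _;
  by apply: eq_bigr => j _; rewrite mulrC.
Qed.

Lemma RicE (mu : bilin E) (X Y : E) : orthonormal_basis ->
  ip (Ric mu X) Y = ric_form mu X Y.
Proof.
move=> [be oe].
pose f := fun X : E => \sum_(k < n) ric_form mu X e`_k *: e`_k.
have lf : linear f.
  move=> a u v; rewrite /f scaler_sumr -big_split; apply: eq_bigr => i _ /=.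
  by rewrite ric_form_linear scalerDl scalerA.
pose fL : {linear E -> E} := HB.pack f (@GRing.isLinear.Build _ _ _ _ f lf).
rewrite /Ric -[linfun _]/(linfun fL) lfunE /= /f.
have ee (i j : 'I_n) : ip e`_i e`_j = (i == j)%:R.
  have := oe; rewrite orthonormalE => /andP[/allP /= n1 /andP[_ po]].
  case: eqVneq => [->|neq].
    by apply/eqP/n1; rewrite mem_nth // size_tuple.
  have sym u v : ip u v = ip v u by rewrite hermC expr0 mul1r.
  have aux (s : seq E) p q : pair_ortho_rec ip s -> (p < q < size s)%N ->
      ip s`_p s`_q = 0.
    elim: s p q => [|x s IH] [|p] [|q] //=; rewrite ?andbF // !andbT.
      by move=> /andP[/allP H _] lt; apply/eqP/H/mem_nth.
    by move=> /andP[_ H] lt; apply: IH.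
  have ne : (i : nat) != j by [].
  case: (ltngtP i j) ne => // lt _.
    by apply: aux => //; rewrite lt size_tuple ltn_ord.
  by rewrite sym; apply: aux => //; rewrite lt size_tuple ltn_ord.
rewrite linear_sumlz /=.
rewrite (coord_basis be (memvf Y)) ric_formC.
pose g : {linear E -> R^o} := HB.pack (ric_form mu ^~ X)
  (@GRing.isLinear.Build R E R^o _ _ (ric_form_linear mu X)).
rewrite -[ric_form mu _ X]/(g _) linear_sum /=; apply: eq_bigr => k _.
rewrite linearZl_LR /= linear_sum /= (bigD1 k) //= big1 => [|i ik].
  rewrite addr0 linearZr_LR /= ee eqxx mulr1 -[RHS]/(g _) linearZ /=.
  by rewrite ric_formC mulrC.
by rewrite linearZr_LR /= ee [k == i]eq_sym (negbTE ik) mulr0.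
Qed.

End Functional.

(* [mu] is a critical point of F: dF vanishes on T_[mu] PV = V / R mu, whose
   vectors are the velocities at t = 0 of the curves t |-> [mu + t la], la in
   V. *)
Definition critical_point (R : realType) (E : vectType R)
    (F : {vspace (bilin E)} -> R) (mu : bilin E) : Prop :=
  forall la : bilin E, skew_bilin la ->
    is_derive (0 : R) (1 : R) (fun t : R => F <[mu + t *: la]>%VS) 0.

(* Main.v *)
(** Ric is the moment map for the action of GL(E) on brackets, so [4 tr (Ric_mu A) =
    <pi(A) mu, mu>] for symmetric [A], and Ric^gamma is the moment map of G_gamma.
    Hence the gradient of [F] at [mu] is, up to a factor, [pi(A) mu - c mu] with
    [A = Ric^gamma_mu]: criticality means that [mu] is an eigenvector of [pi(A)],
    which is condition (iii), and minimality along [exp(tA) mu] already forces it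
    by the equality case of Cauchy-Schwarz.

    Conversely let [pi(A) mu = c mu].  Write [g = k S w] with [k] in K_gamma, [S] in
    G_gamma positive and commuting with [A], and [w] unipotent for the filtration
    by eigenvalues of [A].  Then [S w mu] only has components of weight at least
    [c], so [4 tr (Ric_{g mu} k A k^-1) >= c |g mu|^2], and Cauchy-Schwarz in
    p_gamma gives [F(g mu) >= F(mu)].  In case of equality [w mu = mu] and
    Ric^gamma of [S mu] is proportional to [A]; writing [S = exp B], the derivative
    of the convex function [t |-> log |exp(tB) mu|^2] is the same at [0] and [1],
    so [mu] is an eigenvector of [pi(B)] and [g mu] is proportional to [k mu]. *)

From HB Require Import structures.
Require Import Defs.
From mathcomp Require Import all_boot all_order all_algebra.
From mathcomp Require Import all_classical all_reals all_analysis.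
From mathcomp Require Import complex ring lra.

Set Implicit Arguments.
Unset Strict Implicit.
Unset Printing Implicit Defensive.

Import Order.TTheory GRing.Theory Num.Theory.
Import numFieldNormedType.Exports.
Local Open Scope ring_scope.

(** * Inner products and the spectral theorem *)

(** At a critical point the moment map need not vanish, so [mu] need not minimise the norm on its
    orbit, and convexity along exp(p_gamma) cannot compare it with an arbitrary [g mu]. The
    parabolic subgroup of A is the substitute: acting by its elements never brings in a weight of
    pi(A) below the smallest one present, which bounds the pairing of Ric with a fixed operator from
    below; the factor in K_gamma only rotates that operator. No exponential of operators is needed.
    A symmetric operator is [dg ip f a] in an orthonormal eigenbasis [f], functions of it act on the
    eigenvalues [a], and pi is then diagonal on the structure constants [coord3]. The classes of
    tensors enter through complex structures J that carry the eigenspace of x to that of x or of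
    -x. *)

Section InnerProduct.
Variables (R : realType) (W : vectType R).
Implicit Types (b : W -> W -> R) (x y z : W).

(** A predicate on bare functions, because it serves [ip] on vectors, [hs] on operators, and the
    pull-back of [ip] by a group element. *)
Definition inner_product b : Prop :=
  [/\ forall a x y z, b (a *: x + y) z = a * b x z + b y z,
      forall x y, b x y = b y x & forall x, x != 0 -> 0 < b x x].

Definition ortho_family b k (f : 'I_k -> W) : Prop :=
  forall i j, b (f i) (f j) = (i == j)%:R.

Definition onb b k (f : 'I_k -> W) : Prop :=
  ortho_family b f /\ forall x, x = \sum_i b x (f i) *: f i.

Variable b : W -> W -> R.
Hypothesis Hb : inner_product b.

Lemma innerC x y : b x y = b y x.
Proof. by case: Hb => _ bC _; exact: bC. Qed.

Lemma inner0l z : b 0 z = 0.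
Proof.
case: Hb => bl _ _; have /eqP := bl 1 0 0 z.
by rewrite scaler0 addr0 mul1r -subr_eq subrr eq_sym => /eqP.
Qed.

Lemma innerDl x y z : b (x + y) z = b x z + b y z.
Proof. by case: Hb => bl _ _; have := bl 1 x y z; rewrite scale1r mul1r. Qed.

Lemma innerZl a x z : b (a *: x) z = a * b x z.
Proof.
by case: Hb => bl _ _; have := bl a x 0 z; rewrite addr0 inner0l addr0.
Qed.

Lemma innerNl x z : b (- x) z = - b x z.
Proof. by rewrite -scaleN1r innerZl mulN1r. Qed.

Lemma innerBl x y z : b (x - y) z = b x z - b y z.
Proof. by rewrite innerDl innerNl. Qed.

Lemma inner_suml (I : Type) (r : seq I) (P : pred I) (F : I -> W) z :
  b (\sum_(i <- r | P i) F i) z = \sum_(i <- r | P i) b (F i) z.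
Proof.
elim/big_rec2: _ => [|i x y _ <-]; first exact: inner0l.
exact: innerDl.
Qed.

Lemma inner0r z : b z 0 = 0. Proof. by rewrite innerC inner0l. Qed.

Lemma innerDr x y z : b z (x + y) = b z x + b z y.
Proof. by rewrite innerC innerDl !(innerC z). Qed.

Lemma innerZr a x z : b z (a *: x) = a * b z x.
Proof. by rewrite innerC innerZl innerC. Qed.

Lemma innerNr x z : b z (- x) = - b z x.
Proof. by rewrite innerC innerNl innerC. Qed.

Lemma innerBr x y z : b z (x - y) = b z x - b z y.
Proof. by rewrite innerDr innerNr. Qed.

Lemma inner_sumr (I : Type) (r : seq I) (P : pred I) (F : I -> W) z :
  b z (\sum_(i <- r | P i) F i) = \sum_(i <- r | P i) b z (F i).
Proof. by rewrite innerC inner_suml; apply: eq_bigr => i _; exact: innerC. Qed.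

Lemma inner_gt0 x : x != 0 -> 0 < b x x.
Proof. by case: Hb => _ _ bp; exact: bp. Qed.

Lemma inner_ge0 x : 0 <= b x x.
Proof.
by have [->|/inner_gt0/ltW//] := eqVneq x 0; rewrite inner0l.
Qed.

Lemma inner_eq0 x : b x x = 0 -> x = 0.
Proof.
by move=> h; apply/eqP/negPn/negP => /inner_gt0; rewrite h ltxx.
Qed.

Lemma inner_ext x y : (forall z, b x z = b y z) -> x = y.
Proof.
by move=> h; apply/eqP; rewrite -subr_eq0; apply/eqP/inner_eq0;
  rewrite innerBl h subrr.
Qed.

Lemma cauchy_schwarz x y : b x y ^+ 2 <= b x x * b y y.
Proof.
have [->|y0] := eqVneq y 0; first by rewrite !inner0r mulr0 expr0n.
have yp := inner_gt0 y0.
have := inner_ge0 (b y y *: x - b x y *: y).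
have -> : b (b y y *: x - b x y *: y) (b y y *: x - b x y *: y) =
    b y y * (b x x * b y y - b x y ^+ 2).
  by rewrite !(innerBl, innerBr, innerZl, innerZr) (innerC y x); ring.
by rewrite pmulr_rge0 // subr_ge0.
Qed.

Lemma ortho_family_free k (f : 'I_k -> W) : ortho_family b f ->
  free [tuple f i | i < k].
Proof.
move=> of_; apply/freeP => c h i.
have E (j : 'I_k) : [tuple f i | i < k]`_j = f j.
  by rewrite -tnth_nth tnth_mktuple.
move: h; under eq_bigr do rewrite E.
move=> /(congr1 (fun x => b x (f i))); rewrite inner0l inner_suml.
rewrite (bigD1 i) //= big1 => [|j ji]; first by rewrite innerZl of_ eqxx mulr1 addr0.
by rewrite innerZl of_ (negbTE ji) mulr0.
Qed.

Lemma ortho_family_size k (f : 'I_k -> W) : ortho_family b f ->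
  (k <= \dim {:W})%N.
Proof.
move=> /ortho_family_free fr.
by move: (fr); rewrite /free => /eqP; rewrite size_tuple => <-; exact: dimvS (subvf _).
Qed.

(** Only stability under scaling is asked of [P], so that it can be the set of eigenvectors of an
    operator. The dimension bounds the length of a family, so a longest one exists. *)
Lemma max_ortho_family (P : W -> Prop) :
  (forall a x, P x -> P (a *: x)) ->
  exists k (f : 'I_k -> W), [/\ ortho_family b f, forall i, P (f i) &
    forall x, P x -> (forall i, b x (f i) = 0) -> x = 0].
Proof.
move=> PZ.
pose Q k := `[< exists f : 'I_k -> W, ortho_family b f /\ forall i, P (f i) >].
have Q0 : exists k, Q k.
  by exists 0%N; apply/asboolP; exists (fun=> 0); split => [[]|[]].
have Qb k : Q k -> (k <= \dim {:W})%N.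
  by move=> /asboolP[f [of_ _]]; exact: ortho_family_size of_.
case: (ex_maxnP Q0 Qb) => k /asboolP[f [of_ Pf]] kmax.
exists k, f; split => // x Px xf; apply/eqP/negPn/negP => x0.
have xp := inner_gt0 x0.
pose y := (Num.sqrt (b x x))^-1 *: x.
have yy : b y y = 1.
  rewrite innerZl innerZr mulrA -expr2 exprVn sqr_sqrtr ?ltW //.
  by rewrite mulVf // gt_eqF.
have yf i : b y (f i) = 0 by rewrite innerZl xf mulr0.
pose g (i : 'I_k.+1) := if unlift ord0 i is Some j then f j else y.
suff /kmax : Q k.+1 by rewrite ltnn.
apply/asboolP; exists g; split.
  move=> i j; rewrite /g; case: unliftP => [i' ->|->]; case: unliftP => [j' ->|->].
  - by rewrite of_ (inj_eq lift_inj).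
  - by rewrite innerC yf.
  - by rewrite yf.
  - by rewrite yy eqxx.
by move=> i; rewrite /g; case: unliftP => [j _|_]; [exact: Pf|exact: PZ].
Qed.

Definition linear_pred (Q : W -> Prop) : Prop :=
  Q 0 /\ forall a x y, Q x -> Q y -> Q (a *: x + y).

Lemma linear_pred_scale Q a x : linear_pred Q -> Q x -> Q (a *: x).
Proof. by move=> [Q0 Ql] Qx; rewrite -[_ *: _]addr0; exact: Ql. Qed.

Lemma linear_pred_sum Q (I : Type) (r : seq I) (c : I -> R) (F : I -> W) :
  linear_pred Q -> (forall i, Q (F i)) -> Q (\sum_(i <- r) c i *: F i).
Proof.
move=> [Q0 Ql] QF; elim/big_rec: _ => [//|i x _ Qx]; exact: Ql.
Qed.

Lemma linear_pred_onb (Q : W -> Prop) : linear_pred Q ->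
  exists k (f : 'I_k -> W), [/\ ortho_family b f, forall i, Q (f i) &
    forall x, Q x -> x = \sum_i b x (f i) *: f i].
Proof.
move=> lQ.
have [|k [f [of_ Qf fmax]]] := @max_ortho_family Q.
  by move=> a x; exact: linear_pred_scale.
exists k, f; split => // x Qx; apply/eqP; rewrite -subr_eq0; apply/eqP.
apply: fmax.
  rewrite addrC -scaleN1r; apply: lQ.2 => //.
  exact: linear_pred_sum.
move=> i; rewrite innerBl inner_suml (bigD1 i) //= big1 => [|j ji].
  by rewrite innerZl of_ eqxx mulr1 addr0 subrr.
by rewrite innerZl of_ (negbTE ji) mulr0.
Qed.

Lemma ortho_proj (Q : W -> Prop) x : linear_pred Q ->
  exists2 y, Q y & forall z, Q z -> b (x - y) z = 0.
Proof.
move=> lQ; have [k [f [of_ Qf fs]]] := linear_pred_onb lQ.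
exists (\sum_i b x (f i) *: f i); first exact: linear_pred_sum.
move=> z /fs ->; rewrite inner_sumr big1 // => i _; rewrite innerZr.
rewrite innerBl inner_suml (bigD1 i) //= big1 => [|j ji].
  by rewrite innerZl of_ eqxx mulr1 addr0 subrr mulr0.
by rewrite innerZl of_ (negbTE ji) mulr0.
Qed.

Section Onb.
Variables (k : nat) (f : 'I_k -> W).
Hypothesis Hf : onb b f.

Lemma onb_ext x y : (forall i, b x (f i) = b y (f i)) -> x = y.
Proof.
case: Hf => _ fs h; rewrite [x]fs [y]fs.
by apply: eq_bigr => i _; rewrite h.
Qed.

Lemma parseval x y : b x y = \sum_i b x (f i) * b y (f i).
Proof.
case: Hf => _ fs; rewrite {1}[x]fs inner_suml; apply: eq_bigr => i _.
by rewrite innerZl [b y _]innerC.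
Qed.

(** Expanding each [f i] in [f'] and summing over [i] first, Parseval leaves only the diagonal
    terms. This moves sums over the fixed basis [e] to an eigenbasis. *)
Lemma onb_sum (g : W -> W -> R) k' (f' : 'I_k' -> W) :
  (forall a x y z, g (a *: x + y) z = a * g x z + g y z) ->
  (forall a x y z, g z (a *: x + y) = a * g z x + g z y) ->
  onb b f' -> \sum_i g (f i) (f i) = \sum_j g (f' j) (f' j).
Proof.
move=> gl gr [of' fs'].
have g0l z : g 0 z = 0.
  by have /eqP := gl 1 0 0 z; rewrite scaler0 addr0 mul1r -subr_eq subrr eq_sym => /eqP.
have g0r z : g z 0 = 0.
  by have /eqP := gr 1 0 0 z; rewrite scaler0 addr0 mul1r -subr_eq subrr eq_sym => /eqP.
have gsl (I : finType) (c : I -> R) (F : I -> W) z :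
    g (\sum_i c i *: F i) z = \sum_i c i * g (F i) z.
  by elim/big_rec2: _ => [|i x y _ <-]; rewrite ?g0l ?gl.
have gsr (I : finType) (c : I -> R) (F : I -> W) z :
    g z (\sum_i c i *: F i) = \sum_i c i * g z (F i).
  by elim/big_rec2: _ => [|i x y _ <-]; rewrite ?g0r ?gr.
transitivity (\sum_i \sum_j \sum_l b (f i) (f' j) * b (f i) (f' l) * g (f' j) (f' l)).
  apply: eq_bigr => i _; rewrite {1 2}[f i]fs' gsl; apply: eq_bigr => j _.
  by rewrite gsr big_distrr; apply: eq_bigr => l _ /=; rewrite mulrA.
rewrite exchange_big; apply: eq_bigr => j _ /=.
rewrite exchange_big (bigD1 j) //= [X in _ + X]big1 => [|l lj].
  rewrite addr0 -big_distrl /=.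
  have -> : \sum_i b (f i) (f' j) * b (f i) (f' j) = b (f' j) (f' j).
    by rewrite (parseval (f' j)); apply: eq_bigr => i _; rewrite !(innerC (f' j)).
  by rewrite of' eqxx mul1r.
rewrite -big_distrl /=.
have -> : \sum_i b (f i) (f' j) * b (f i) (f' l) = b (f' j) (f' l).
  rewrite parseval; apply: eq_bigr => i _.
  by rewrite !(innerC (f i)).
by rewrite of' eq_sym (negbTE lj) mul0r.
Qed.

Lemma lmap_subproof (V : vectType R) (h : 'I_k -> V) :
  linear (fun x => \sum_i b x (f i) *: h i).
Proof.
move=> a x y; rewrite scaler_sumr -big_split; apply: eq_bigr => i _ /=.
by rewrite innerDl innerZl scalerDl scalerA.
Qed.

Definition lmap (V : vectType R) (h : 'I_k -> V) : 'Hom(W, V) :=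
  linfun (fun x => \sum_i b x (f i) *: h i).

Lemma lmapE (V : vectType R) (h : 'I_k -> V) x :
  lmap h x = \sum_i b x (f i) *: h i.
Proof.
pose g := fun x => \sum_i b x (f i) *: h i.
pose gL : {linear W -> V} :=
  HB.pack g (@GRing.isLinear.Build _ _ _ _ g (lmap_subproof h)).
by rewrite /lmap -[linfun _]/(linfun gL) lfunE.
Qed.

Lemma lmap_onb (V : vectType R) (h : 'I_k -> V) i : lmap h (f i) = h i.
Proof.
case: Hf => of_ _; rewrite lmapE (bigD1 i) //= big1 => [|j ji].
  by rewrite of_ eqxx scale1r addr0.
by rewrite of_ eq_sym (negbTE ji) scale0r.
Qed.

Lemma lfun_onb (V : vectType R) (g h : 'Hom(W, V)) :
  (forall i, g (f i) = h (f i)) -> g = h.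
Proof.
move=> gh; apply/lfunP => x; case: Hf => _ fs; rewrite [x]fs !linear_sum.
by apply: eq_bigr => i _; rewrite !linearZ /= gh.
Qed.

End Onb.

End InnerProduct.

Section RealSymmetricEigenvector.
Variable R : realType.
Local Open Scope complex_scope.

(** Over the algebraically closed [R[i]] there is an eigenvector x + iy. Symmetry of [M] makes the
    imaginary part of its eigenvalue, times |x|^2 + |y|^2, vanish; then x or y is a real
    eigenvector. *)
Lemma symmetric_mx_eigenvector m (M : 'M[R]_m) : (0 < m)%N -> M^T = M ->
  exists (v : 'rV[R]_m) (l : R), v != 0 /\ v *m M = l *: v.
Proof.
move=> m0 Ms.
have [l] := eigenvalue_closed (map_mx (real_complex R) M) m0.
move=> /eigenvalueP[v vM v0].
pose x := \row_j complex.Re (v 0 j); pose y := \row_j complex.Im (v 0 j).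
pose al := complex.Re l; pose be := complex.Im l.
have key j : (x *m M) 0 j = al * x 0 j - be * y 0 j /\
             (y *m M) 0 j = al * y 0 j + be * x 0 j.
  have := congr1 (fun w : 'rV_m => w 0 j) vM.
  rewrite !mxE => h.
  have hR := congr1 (@complex.Re R) h; have hI := congr1 (@complex.Im R) h.
  move: hR hI; rewrite !raddf_sum /= => hR hI; split.
    transitivity (complex.Re (l * v 0 j)).
      rewrite -hR; apply: eq_bigr => i _; rewrite !mxE.
      by case: (v 0 i) => p q /=; rewrite mulr0 subr0.
    by rewrite /al /be; case: (l) => p q; case: (v 0 j) => r s.
  transitivity (complex.Im (l * v 0 j)).
    rewrite -hI; apply: eq_bigr => i _; rewrite !mxE.
    by case: (v 0 i) => p q /=; rewrite mulr0 add0r.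
  by rewrite /al /be; case: (l) => p q; case: (v 0 j) => r s.
have xM : x *m M = al *: x - be *: y.
  by apply/rowP => j; have [-> _] := key j; rewrite !mxE.
have yM : y *m M = al *: y + be *: x.
  by apply/rowP => j; have [_ ->] := key j; rewrite !mxE.
have sq (u : 'rV[R]_m) : 0 <= (u *m u^T) 0 0 /\ ((u *m u^T) 0 0 = 0 -> u = 0).
  rewrite mxE; have pos i : true -> 0 <= u 0 i * u^T i 0.
    by move=> _; rewrite mxE -expr2 sqr_ge0.
  split; first by apply: sumr_ge0 => i _; exact: pos.
  move=> /eqP; rewrite psumr_eq0 // => /allP h; apply/rowP => j.
  have := h j (mem_index_enum j); rewrite /= !mxE mulf_eq0 orbb.
  by move/eqP.
have sym : (x *m M *m y^T) 0 0 = (y *m M *m x^T) 0 0.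
  have -> : y *m M *m x^T = (x *m M *m y^T)^T.
    by rewrite !trmx_mul trmxK Ms mulmxA.
  by rewrite [RHS]mxE.
have xy : (x *m y^T) 0 0 = (y *m x^T) 0 0.
  have -> : y *m x^T = (x *m y^T)^T by rewrite trmx_mul trmxK.
  by rewrite [RHS]mxE.
have entB (P Q : 'M[R]_1) a c : (a *: P - c *: Q) 0 0 = a * P 0 0 - c * Q 0 0.
  by rewrite !mxE.
have entD (P Q : 'M[R]_1) a c : (a *: P + c *: Q) 0 0 = a * P 0 0 + c * Q 0 0.
  by rewrite !mxE.
have be0 : be = 0.
  apply/eqP/negPn/negP => be0.
  have : be * ((x *m x^T) 0 0 + (y *m y^T) 0 0) = 0.
    move: sym; rewrite xM yM mulmxBl mulmxDl -!scalemxAl entB entD -xy.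
    set u := (x *m y^T) 0 0; set w := (y *m y^T) 0 0; set z := (x *m x^T) 0 0.
    by move=> h; lra.
  move=> /eqP; rewrite mulf_eq0 (negbTE be0) /= paddr_eq0 ?(sq _).1 //.
  move=> /andP[/eqP/(sq _).2 x0 /eqP/(sq _).2 y0]; case/eqP: v0.
  apply/rowP => j; rewrite mxE.
  have := congr1 (fun u : 'rV_m => u 0 j) x0.
  have := congr1 (fun u : 'rV_m => u 0 j) y0.
  by rewrite !mxE; case: (v 0 j) => p q /= -> ->.
have [x0|x0] := eqVneq x 0; last first.
  by exists x, al; split => //; rewrite xM be0 scale0r subr0.
exists y, al; split; last by rewrite yM be0 scale0r addr0.
apply: contraNneq v0 => y0; apply/eqP/rowP => j; rewrite mxE.
have := congr1 (fun u : 'rV_m => u 0 j) x0.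
have := congr1 (fun u : 'rV_m => u 0 j) y0.
by rewrite !mxE; case: (v 0 j) => p q /= -> ->.
Qed.

End RealSymmetricEigenvector.

(** The orthogonal complement of a maximal orthonormal family of eigenvectors is stable under [A];
    were it nonzero, the matrix of the restriction would supply one more eigenvector. *)
Lemma symmetric_onb (R : realType) (W : vectType R) (b : W -> W -> R)
    (Hb : inner_product b) (A : 'End(W)) :
  (forall x y, b (A x) y = b x (A y)) ->
  exists k (f : 'I_k -> W) (a : 'I_k -> R),
    onb b f /\ forall i, A (f i) = a i *: f i.
Proof.
move=> As.
have [|k [f [of_ Af fmax]]] :=
  max_ortho_family Hb (P := fun x => exists a, A x = a *: x).
  move=> c x [a Ax]; exists a.
  by rewrite linearZ /= Ax !scalerA mulrC.
have [a Ea] := choice Af.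
exists k, f, a; split=> //; split=> // x.
pose Q y := forall i, b y (f i) = 0.
have lQ : linear_pred Q.
  split=> [i|c y z Qy Qz i]; first exact: inner0l.
  by rewrite innerDl // innerZl // Qy Qz mulr0 addr0.
have AQ y : Q y -> Q (A y).
  by move=> Qy i; rewrite As Ea innerZr // Qy mulr0.
have [m [g [og Qg gs]]] := linear_pred_onb Hb lQ.
have gA y : Q y -> A y = \sum_j b (A y) (g j) *: g j by move=> /AQ/gs.
have m0 : m = 0%N.
  case: m => [//|m] in g og Qg gs gA *.
  pose M := \matrix_(i < m.+1, j < m.+1) b (A (g i)) (g j).
  have [|//|v [l [v0 vM]]] := @symmetric_mx_eigenvector R _ M.
    by [].
    by apply/matrixP => i j; rewrite !mxE As innerC.
  pose y := \sum_i v 0 i *: g i.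
  have Qy : Q y by apply: linear_pred_sum.
  have yg j : b y (g j) = v 0 j.
    rewrite /y inner_suml // (bigD1 j) //= big1 => [|i ij].
      by rewrite innerZl // og eqxx mulr1 addr0.
    by rewrite innerZl // og (negbTE ij) mulr0.
  have Ay : A y = l *: y.
    rewrite gA // /y scaler_sumr; apply: eq_bigr => j _.
    rewrite scalerA; congr (_ *: _).
    have := congr1 (fun u : 'rV_m.+1 => u 0 j) vM; rewrite !mxE => <-.
    rewrite linear_sum inner_suml //; apply: eq_bigr => i _.
    by rewrite linearZ /= innerZl // mxE.
  have y0 : y = 0 by apply: fmax => //; exists l.
  case/eqP: v0; apply/rowP => j; by rewrite mxE -yg y0 inner0l.
have := fmax (x - \sum_i b x (f i) *: f i).
have Qx : Q (x - \sum_i b x (f i) *: f i).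
  move=> i; rewrite innerBl // inner_suml // (bigD1 i) //= big1 => [|j ji].
    by rewrite innerZl // of_ eqxx mulr1 addr0 subrr.
  by rewrite innerZl // of_ (negbTE ji) mulr0.
have x0 : x - \sum_i b x (f i) *: f i = 0.
  by rewrite (gs _ Qx) big1 // => -[i ii]; exfalso; rewrite m0 in ii.
by move=> _; apply/eqP; rewrite -subr_eq0 x0.
Qed.

(** * Diagonal operators and the Ricci operator *)

Section Euclidean.
Variables (R : realType) (E : vectType R) (ip : {dot E for idfun}).

Lemma ip_inner : inner_product (ip : E -> E -> R).
Proof.
split=> [a x y z|x y|x /neq0_dnorm_gt0//].
  by rewrite linearDl linearZl_LR.
by rewrite hermC expr0 mul1r.
Qed.

Notation Hip := ip_inner.

Lemma orthonormal_basis_onb n (e : n.-tuple E) :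
  orthonormal_basis ip e -> onb ip (fun i : 'I_n => e`_i).
Proof.
move=> [be oe].
have of_ : ortho_family ip (fun i : 'I_n => e`_i).
  move=> i j; have := oe; rewrite orthonormalE => /andP[/allP /= n1 /andP[_ po]].
  case: eqVneq => [->|neq].
    by apply/eqP/n1; rewrite mem_nth // size_tuple.
  have aux (s : seq E) p q : pair_ortho_rec ip s -> (p < q < size s)%N ->
      ip s`_p s`_q = 0.
    elim: s p q => [|x s IH] [|p] [|q] //=; rewrite ?andbF // !andbT.
      by move=> /andP[/allP H _] lt; apply/eqP/H/mem_nth.
    by move=> /andP[_ H] lt; apply: IH.
  have ne : (i : nat) != j by [].
  case: (ltngtP i j) ne => // lt _.
    by apply: aux => //; rewrite lt size_tuple ltn_ord.
  by rewrite (innerC Hip); apply: aux => //; rewrite lt size_tuple ltn_ord.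
split=> // x; apply: (ip_basis (ip := ip) be) => k.
rewrite (inner_suml Hip) (bigD1 k) //= big1 => [|i ik].
  by rewrite (innerZl Hip) of_ eqxx mulr1 addr0.
by rewrite (innerZl Hip) of_ (negbTE ik) mulr0.
Qed.

Section Diagonal.
Variables (k : nat) (f : 'I_k -> E).

Definition dg (d : 'I_k -> R) : 'End(E) := lmap ip f (fun i => d i *: f i).

Hypothesis Hf : onb ip f.

Lemma dg_onb d i : dg d (f i) = d i *: f i.
Proof. exact: (lmap_onb Hip Hf). Qed.

Lemma dg_unique d (A : 'End(E)) : (forall i, A (f i) = d i *: f i) -> A = dg d.
Proof. by move=> h; apply: (lfun_onb Hf) => i; rewrite h dg_onb. Qed.

Lemma dg_ip d x y : ip (dg d x) y = \sum_i d i * ip x (f i) * ip y (f i).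
Proof.
rewrite (lmapE Hip) (inner_suml Hip); apply: eq_bigr => i _.
by rewrite !(innerZl Hip) (innerC Hip (f i)) mulrCA mulrA.
Qed.

Lemma dg_sym d x y : ip (dg d x) y = ip x (dg d y).
Proof.
rewrite (innerC Hip x) !dg_ip; apply: eq_bigr => i _.
by rewrite -!mulrA [ip y _ * _]mulrC.
Qed.

Lemma dg_coord d x i : ip (dg d x) (f i) = d i * ip x (f i).
Proof. by rewrite dg_sym dg_onb (innerZr Hip). Qed.

Lemma dg_dg d d' x : dg d (dg d' x) = dg (fun i => d i * d' i) x.
Proof.
by apply: (onb_ext Hf) => i; rewrite !dg_coord mulrA.
Qed.

Lemma dg1 x : dg (fun=> 1) x = x.
Proof. by apply: (onb_ext Hf) => i; rewrite dg_coord mul1r. Qed.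

End Diagonal.

(** An entry of [X] between eigenvectors is zero unless their eigenvalues agree, and then so do the
    values of [phi]. Allowing two different diagonal operators covers the sign or inverse produced
    by J. *)
Lemma dg_intertwine k (f : 'I_k -> E) d k' (f' : 'I_k' -> E) d' (X : 'End(E)) :
  onb ip f -> onb ip f' -> (forall x, X (dg f d x) = dg f' d' (X x)) ->
  forall (phi : R -> R) x, X (dg f (phi \o d) x) = dg f' (phi \o d') (X x).
Proof.
move=> Hf Hf' h phi x.
rewrite -[X (dg _ _ x)]comp_lfunE -[dg _ _ (X x)]comp_lfunE.
congr (fun_of_lfun _ x); apply: (lfun_onb Hf) => i.
rewrite !comp_lfunE dg_onb // linearZ /=.
apply: (onb_ext Hf') => j; rewrite dg_coord // (innerZl Hip) /=.
have := congr1 (fun y => ip y (f' j)) (h (f i)).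
rewrite /= dg_onb // linearZ /= (innerZl Hip) dg_coord // => /eqP.
rewrite -subr_eq0 -mulrBl mulf_eq0 subr_eq0 => /orP[/eqP -> //|/eqP ->].
by rewrite !mulr0.
Qed.

Definition adj k (f : 'I_k -> E) (g : 'End(E)) : 'End(E) :=
  linfun (fun x : E => \sum_i ip x (g (f i)) *: f i).

Lemma adjE k (f : 'I_k -> E) (g : 'End(E)) x y : onb ip f ->
  ip (adj f g x) y = ip x (g y).
Proof.
move=> Hf; pose h := fun x : E => \sum_i ip x (g (f i)) *: f i.
have lh : linear h.
  move=> a u v; rewrite /h scaler_sumr -big_split; apply: eq_bigr => i _ /=.
  by rewrite (innerDl Hip) (innerZl Hip) scalerDl scalerA.
pose hL : {linear E -> E} := HB.pack h (@GRing.isLinear.Build _ _ _ _ h lh).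
rewrite /adj -[linfun _]/(linfun hL) lfunE /= /h (inner_suml Hip).
case: Hf => _ fs; rewrite {2}[y]fs linear_sum (inner_sumr Hip).
by apply: eq_bigr => i _; rewrite linearZ /= (innerZl Hip) (innerZr Hip) mulrC (innerC Hip y).
Qed.

Definition coord3 k (f : 'I_k -> E) (mu : bilin E) (I : 'I_k * 'I_k * 'I_k) : R :=
  ip (mu (f I.1.1) (f I.1.2)) (f I.2).

(** Eigenvalue of pi([dg ip f a]) on the bilinear map whose only structure constant sits at [I]. *)
Definition weight k (a : 'I_k -> R) (I : 'I_k * 'I_k * 'I_k) : R :=
  a I.2 - a I.1.1 - a I.1.2.

Lemma sum3E k (F : 'I_k -> 'I_k -> 'I_k -> R) :
  \sum_i \sum_j \sum_l F i j l =
  \sum_(I : 'I_k * 'I_k * 'I_k) F I.1.1 I.1.2 I.2.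
Proof. by rewrite pair_big pair_big. Qed.

Lemma coord3_ext k (f : 'I_k -> E) (mu la : bilin E) : onb ip f ->
  (forall I, coord3 f mu I = coord3 f la I) -> mu = la.
Proof.
move=> Hf h; apply: (lfun_onb Hf) => i; apply: (lfun_onb Hf) => j.
by apply: (onb_ext Hf) => l; exact: (h (i, j, l)).
Qed.

Section Traces.
Variables (n : nat) (e : n.-tuple E).
Hypothesis he : orthonormal_basis ip e.
Let He : onb ip (fun i : 'I_n => e`_i) := orthonormal_basis_onb he.

(** For symmetric [A] this is the trace of [A \o B], but it is positive definite on all operators,
    so that [ortho_proj] applies. *)
Definition hs (A B : 'End(E)) : R := \sum_(i < n) ip (A e`_i) (B e`_i).

Lemma hs_inner : inner_product hs.
Proof.
split=> [a A B C|A B|A A0].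
- rewrite /hs big_distrr -big_split; apply: eq_bigr => i _ /=.
  by rewrite add_lfunE scale_lfunE (innerDl Hip) (innerZl Hip).
- by apply: eq_bigr => i _; rewrite (innerC Hip).
rewrite lt_neqAle; apply/andP; split; last first.
  by apply: sumr_ge0 => i _; exact: (inner_ge0 Hip).
rewrite eq_sym psumr_eq0 => [|i _]; last exact: (inner_ge0 Hip).
apply: contra A0 => /allP h; apply/eqP/(lfun_onb He) => i.
rewrite zero_lfunE; apply: (inner_eq0 Hip).
by have /eqP := h i (mem_index_enum i).
Qed.

Lemma trace_hs A B : symmetric_map ip A -> trace ip e (A \o B)%VF = hs A B.
Proof.
by move=> As; apply: eq_bigr => i _; rewrite comp_lfunE As (innerC Hip).
Qed.

Lemma hs_onb k (f : 'I_k -> E) A B : onb ip f ->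
  hs A B = \sum_i ip (A (f i)) (B (f i)).
Proof.
move=> Hf; apply: (onb_sum Hip He (g := fun x y => ip (A x) (B y))) => //.
  by move=> a x y z; rewrite linearP (innerDl Hip) (innerZl Hip).
by move=> a x y z; rewrite linearP (innerDr Hip) (innerZr Hip).
Qed.

Lemma ip_bilinE k (f : 'I_k -> E) mu la : onb ip f ->
  ip_bilin ip e mu la = \sum_I coord3 f mu I * coord3 f la I.
Proof.
move=> Hf; rewrite /ip_bilin -(sum3E (fun i j l => coord3 f mu (i,j,l) * coord3 f la (i,j,l))).
transitivity (\sum_(i < n) \sum_(j < n) ip (mu e`_i e`_j) (la e`_i e`_j)).
  apply: eq_bigr => i _; apply: eq_bigr => j _; exact/esym/(parseval Hip He).
transitivity (\sum_(i < n) \sum_j ip (mu e`_i (f j)) (la e`_i (f j))).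
  apply: eq_bigr => i _.
  apply: (onb_sum Hip He (g := fun x y => ip (mu e`_i x) (la e`_i y))) => //.
    by move=> a x y z; rewrite linearP (innerDl Hip) (innerZl Hip).
  by move=> a x y z; rewrite linearP (innerDr Hip) (innerZr Hip).
rewrite exchange_big /= [RHS]exchange_big /=; apply: eq_bigr => j _.
rewrite (onb_sum Hip He (g := fun x y => ip (mu x (f j)) (la y (f j))) _ _ Hf).
- by apply: eq_bigr => i _; exact: (parseval Hip Hf).
- by move=> a x y z; rewrite linearP add_lfunE scale_lfunE (innerDl Hip) (innerZl Hip).
- by move=> a x y z; rewrite linearP add_lfunE scale_lfunE (innerDr Hip) (innerZr Hip).
Qed.

Lemma ric_formE k (f : 'I_k -> E) mu X Y : onb ip f ->
  ric_form ip e mu X Y =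
  - (1 / 2) * (\sum_i \sum_j ip (mu X (f i)) (f j) * ip (mu Y (f i)) (f j))
  + (1 / 4) * (\sum_i \sum_j ip (mu (f i) (f j)) X * ip (mu (f i) (f j)) Y).
Proof.
move=> Hf; rewrite /ric_form; congr (_ * _ + _ * _).
  transitivity (\sum_(i < n) ip (mu X e`_i) (mu Y e`_i)).
    by apply: eq_bigr => i _; exact/esym/(parseval Hip He).
  rewrite (onb_sum Hip He (g := fun x y => ip (mu X x) (mu Y y)) _ _ Hf).
  - by apply: eq_bigr => i _; exact: (parseval Hip Hf).
  - by move=> a x y z; rewrite linearP (innerDl Hip) (innerZl Hip).
  - by move=> a x y z; rewrite linearP (innerDr Hip) (innerZr Hip).
transitivity (\sum_(i < n) \sum_j ip (mu e`_i (f j)) X * ip (mu e`_i (f j)) Y).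
  apply: eq_bigr => i _.
  apply: (onb_sum Hip He (g := fun x y => ip (mu e`_i x) X * ip (mu e`_i y) Y)) => //.
    by move=> a x y z; rewrite linearP (innerDl Hip) (innerZl Hip) mulrDl mulrA.
  by move=> a x y z; rewrite linearP (innerDl Hip) (innerZl Hip) mulrDr mulrCA.
rewrite exchange_big /= [RHS]exchange_big /=; apply: eq_bigr => j _.
rewrite (onb_sum Hip He (g := fun x y => ip (mu x (f j)) X * ip (mu y (f j)) Y) _ _ Hf) //.
- by move=> a x y z; rewrite linearP add_lfunE scale_lfunE (innerDl Hip) (innerZl Hip)
    mulrDl mulrA.
- by move=> a x y z; rewrite linearP add_lfunE scale_lfunE (innerDl Hip) (innerZl Hip)
    mulrDr mulrCA.
Qed.

Lemma Ric_sym mu : symmetric_map ip (Ric ip e mu).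
Proof. by move=> X Y; rewrite (innerC Hip X) !RicE // ric_formC. Qed.

(* [Ric] is the moment map of the action of GL(E) on the space of brackets:
   [<pi(A) mu, mu> = 4 tr (Ric_mu A)], written in an eigenbasis of [A]. *)
Lemma hs_Ric_dg k (f : 'I_k -> E) (a : 'I_k -> R) mu : onb ip f -> skew_bilin mu ->
  4 * hs (Ric ip e mu) (dg f a) = \sum_I weight a I * coord3 f mu I ^+ 2.
Proof.
move=> Hf smu; pose c i j l := coord3 f mu (i, j, l).
have E1 : hs (Ric ip e mu) (dg f a) =
    \sum_i a i * (- (1 / 2) * (\sum_j \sum_l c i j l ^+ 2)
                  + (1 / 4) * (\sum_j \sum_l c j l i ^+ 2)).
  rewrite (hs_onb _ _ Hf); apply: eq_bigr => i _.
  by rewrite dg_onb // (innerZr Hip) RicE // (ric_formE _ _ _ Hf).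
(* [s1] weights the squares by an input, [s3] by the output. By skew-symmetry both inputs contribute
   [s1], so the right side is s3 - 2 s1, four times -(1/2) s1 + (1/4) s3. *)
pose s1 := \sum_i \sum_j \sum_l a i * c i j l ^+ 2.
have s2E : s1 = \sum_i \sum_j \sum_l a j * c i j l ^+ 2.
  rewrite /s1 exchange_big; apply: eq_bigr => i _; apply: eq_bigr => j _.
  apply: eq_bigr => l _; congr (_ * _).
  by rewrite /c /coord3 /= smu (innerNl Hip) sqrrN.
pose s3 := \sum_i \sum_j \sum_l a l * c i j l ^+ 2.
have s3E : s3 = \sum_i \sum_j \sum_l a i * c j l i ^+ 2.
  rewrite /s3; under eq_bigr => i _ do rewrite exchange_big.
  by rewrite exchange_big; apply: eq_bigr => l _.
have -> : \sum_I weight a I * coord3 f mu I ^+ 2 = s3 - s1 - s1.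
  rewrite {1}s2E /s1 /s3 !sum3E -!sumrB; apply: eq_bigr => -[[i j] l] _ /=.
  by rewrite /weight /= /c; ring.
rewrite E1 s3E.
have -> : \sum_i a i * (- (1 / 2) * (\sum_j \sum_l c i j l ^+ 2) +
             1 / 4 * (\sum_j \sum_l c j l i ^+ 2)) =
   - (1 / 2) * s1 + 1 / 4 * (\sum_i \sum_j \sum_l a i * c j l i ^+ 2).
  rewrite /s1 !big_distrr -big_split; apply: eq_bigr => i _ /=.
  rewrite mulrDr mulrCA [a i * (1 / 4 * _)]mulrCA; congr (_ * _ + _ * _);
    rewrite big_distrr; apply: eq_bigr => j _ /=; by rewrite big_distrr.
by field.
Qed.

End Traces.

End Euclidean.

(** * One-variable calculus *)

Section RealDerivatives.
Variable R : realType.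
Implicit Types (g h : R -> R).

Lemma is_derive_bigsum (I : Type) (r : seq I) (h : I -> R -> R) (dh : I -> R) (x : R) :
  (forall i, is_derive x (1 : R) (h i) (dh i)) ->
  is_derive x (1 : R) (fun t => \sum_(i <- r) h i t) (\sum_(i <- r) dh i).
Proof.
move=> dhi; elim: r => [|i r IH].
  have -> : (fun t => \sum_(i <- [::]) h i t) = cst 0.
    by apply/funext => t; rewrite big_nil.
  by rewrite big_nil; exact: is_derive_cst.
have -> : (fun t => \sum_(j <- i :: r) h j t) = h i + (fun t => \sum_(j <- r) h j t).
  by apply/funext => t; rewrite big_cons.
by rewrite big_cons; exact: is_deriveD.
Qed.

Lemma is_derive_unique (g : R -> R) (x a b : R) :
  is_derive x (1 : R) g a -> is_derive x (1 : R) g b -> a = b.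
Proof. by move=> [_ <-] [_ <-]. Qed.

Lemma is_derive_scal g (c x d : R) :
  is_derive x (1 : R) g d -> is_derive x (1 : R) (fun t => c * g t) (c * d).
Proof. by move=> dg; have := is_deriveZ c dg. Qed.

Lemma is_derive_sqr g (x d : R) :
  is_derive x (1 : R) g d ->
  is_derive x (1 : R) (fun t => g t ^+ 2) (2 * g x * d).
Proof.
move=> dg; have := is_deriveM dg dg.
have -> : g * g = (fun t => g t ^+ 2) by apply/funext => t; rewrite expr2.
move=> h; apply: (is_derive_eq h); rewrite /GRing.scale /=; ring.
Qed.

Lemma is_derive_ratio g h (x dg dh : R) : h x != 0 ->
  is_derive x (1 : R) g dg -> is_derive x (1 : R) h dh ->
  is_derive x (1 : R) (fun t => g t / h t ^+ 2)
    (dg / h x ^+ 2 - 2 * g x * dh / h x ^+ 3).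
Proof.
move=> h0 Dg /is_derive_sqr Dh2.
have h20 : h x ^+ 2 != 0 by rewrite expf_neq0.
have := is_deriveM Dg (@is_deriveV R (fun t => h t ^+ 2) _ _ _ h20 Dh2).
move=> H; apply: (is_derive_eq H); rewrite /GRing.scale /= /GRing.scale /=.
by field.
Qed.

Lemma is_derive_expR_lin (a : R) :
  is_derive (0 : R) (1 : R) (fun t => expR (t * a)) a.
Proof.
have dl : is_derive (0 : R) (1 : R) (fun t : R => t * a) a.
  have -> : (fun t : R => t * a) = a \*: id.
    by apply/funext => t; rewrite mulrC.
  by apply: is_derive_eq; rewrite /GRing.scale /= mulr1.
have := @is_derive1_comp R expR (fun t => t * a) 0 _ _ (is_derive_expR _) dl.
by rewrite mul0r expR0 mul1r.
Qed.

Lemma is_derive_at_min g (d : R) : is_derive (0 : R) (1 : R) g d ->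
  (forall t, g 0 <= g t) -> d = 0.
Proof.
move=> [dg <-] gmin; apply/eqP/negPn/negP => d0.
set D := 'D_1 g 0 in d0 *.
have C : ((fun h : R => h^-1 *: (g (h *: 1 + 0) - g 0)) @ 0^' --> D)%classic by exact: dg.
have D0 : 0 < `|D| by rewrite normr_gt0.
(* With tolerance |D| the difference quotients near 0 must have the sign of D; at a minimum this
   fails on one side, where the step of length [r / 2] is taken. *)
move/cvgrPdist_lt: C => /(_ _ D0).
rewrite near_withinE => /nbhs_ballP[r /= r0 H].
have r2 : 0 < r / 2 by rewrite divr_gt0.
have Hball (h : R) : `|h| = r / 2 -> `|D - h^-1 * (g h - g 0)| < `|D|.
  move=> hr; have := H h; rewrite /ball /= sub0r normrN hr [h%:A]mulr1 addr0; apply.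
    by rewrite gtr_pMr // invf_lt1 // ltr1n.
  by rewrite -normr_eq0 hr gt_eqF.
have [Dp|Dn] := ltP 0 D.
  have := Hball (- (r / 2)); rewrite normrN gtr0_norm // => /(_ erefl).
  have q0 : (- (r / 2))^-1 * (g (- (r / 2)) - g 0) <= 0.
    by rewrite mulr_le0_ge0 ?invr_le0 ?oppr_le0 ?(ltW r2) // subr_ge0.
  rewrite (gtr0_norm Dp) => /(le_lt_trans (ler_norm _)); lra.
have {Dn} Dn : D < 0 by rewrite lt_neqAle d0.
have := Hball (r / 2); rewrite gtr0_norm // => /(_ erefl).
have q0 : 0 <= (r / 2)^-1 * (g (r / 2) - g 0).
  by rewrite mulr_ge0 ?invr_ge0 ?(ltW r2) // subr_ge0.
rewrite (ltr0_norm Dn) distrC => /(le_lt_trans (ler_norm _)); lra.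
Qed.

End RealDerivatives.

(** * The group of a structure and its Cartan decomposition *)

Section Structures.
Variables (R : realType) (E : vectType R) (ip : {dot E for idfun}).
Notation Hip := (ip_inner ip).

Lemma invertibleP (g h : 'End(E)) : (forall x, h (g x) = x) -> invertible g.
Proof.
move=> hg; apply/eqP/lker0P => x y gxy.
by rewrite -[x]hg gxy hg.
Qed.

Lemma invertibleK (g : 'End(E)) x : invertible g -> (g^-1)%VF (g x) = x.
Proof. by move=> /eqP h; rewrite lker0_lfunK. Qed.

Lemma invertibleVK (g : 'End(E)) x : invertible g -> g ((g^-1)%VF x) = x.
Proof. by move=> /eqP h; rewrite lker0_lfunVK. Qed.

Lemma invertible_inv (g : 'End(E)) : invertible g -> invertible (g^-1)%VF.
Proof. by move=> gi; apply: (@invertibleP _ g) => x; exact: invertibleVK. Qed.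

Lemma invertible_comp (g h : 'End(E)) :
  invertible g -> invertible h -> invertible (g \o h)%VF.
Proof.
move=> gi hi; apply: (@invertibleP _ (h^-1 \o g^-1)%VF) => x.
by rewrite !comp_lfunE !invertibleK.
Qed.

Lemma inv_unique (g h : 'End(E)) : (forall x, h (g x) = x) -> (g^-1)%VF = h.
Proof.
move=> hg; have gi := invertibleP hg.
by apply/lfunP => x; rewrite -[in RHS](invertibleVK x gi) hg.
Qed.

Definition compatible_structure (J : 'End(E)) : Prop :=
  (forall X Y, ip (J X) Y = - ip X (J Y)) /\ forall X, J (J X) = - X.

Definition preserves (s : bool) (Js : seq 'End(E)) (phi : 'End(E)) : Prop :=
  forall J, J \in Js ->
    if s then forall X Y, ip (phi X) (J (phi Y)) = ip X (J Y)
    else forall X, phi (J X) = J (phi X).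

(* The four classes of tensors, uniformly: G_gamma preserves either the forms
   [<X, J Y>] (symplectic case, [s = true]) or the endomorphisms [J]. *)
Lemma structure_of_tensors (gamma : tensors E) :
  class_tensors gamma -> compatible ip gamma ->
  exists (s : bool) (Js : seq 'End(E)),
    (forall J, J \in Js -> compatible_structure J) /\
    forall phi, invertible phi -> (fixes phi gamma <-> preserves s Js phi).
Proof.
have cs J : almost_complex J -> orthogonal_map ip J -> compatible_structure J.
  move=> J2 Jo; have JJ X : J (J X) = - X.
    by rewrite -comp_lfunE J2 opp_lfunE id_lfunE.
  split=> // X Y; have := Jo X (J Y).
  by rewrite JJ (innerNr Hip) => <-; rewrite opprK.
have fixE (J phi : 'End(E)) : invertible phi ->
    ((phi \o J \o phi^-1)%VF = J <-> forall X, phi (J X) = J (phi X)).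
  move=> phii; split=> [h X|h].
    by rewrite -[in RHS]h !comp_lfunE invertibleK.
  by apply/lfunP => X; rewrite !comp_lfunE h invertibleVK.
case: gamma => [|omega|J|J1 J2 J3] /=.
- by move=> _ _; exists false, [::]; split.
- move=> _ [J [oJ J2]]; exists true, [:: J]; split=> [J'|phi phii].
    rewrite inE => /eqP -> {J'}; have JJ X : J (J X) = - X.
      by rewrite -comp_lfunE J2 opp_lfunE id_lfunE.
    split=> // X Y; rewrite -oJ (innerC Hip) -oJ hermC expr1 mulN1r.
    by [].
  split=> [h J'|h X Y].
    by rewrite inE => /eqP -> X Y; rewrite -!oJ -h !invertibleK.
  by rewrite !oJ -(h J) ?inE // !invertibleVK.
- move=> J2 Jo; exists false, [:: J]; split=> [J'|phi phii].
    by rewrite inE => /eqP ->; exact: cs.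
  rewrite fixE //; split => [h J'|h]; last by apply: (h J); rewrite inE.
  by rewrite inE => /eqP ->.
move=> [c1 c2 c3 _ _] [ho1 ho2 ho3]; exists false, [:: J1; J2; J3].
split=> [J'|phi phii].
  by rewrite !inE => /or3P[] /eqP ->; exact: cs.
split=> [[/(fixE _ _ phii) h1 /(fixE _ _ phii) h2 /(fixE _ _ phii) h3] J'|h].
  by rewrite !inE => /or3P[] /eqP ->.
by split; apply/(fixE _ _ phii)/h; rewrite !inE eqxx ?orbT.
Qed.

Variables (gamma : tensors E) (s : bool) (Js : seq 'End(E)).
Hypothesis HJ : forall J, J \in Js -> compatible_structure J.
Hypothesis HG : forall phi, invertible phi -> (fixes phi gamma <-> preserves s Js phi).

Lemma GP phi : G_ gamma phi <-> invertible phi /\ preserves s Js phi.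
Proof. by split=> -[phii /(HG phii)]. Qed.

Lemma preserves_comp phi psi :
  preserves s Js phi -> preserves s Js psi -> preserves s Js (phi \o psi)%VF.
Proof.
move=> hphi hpsi J JJ; move: (hphi J JJ) (hpsi J JJ).
case: ifP => _ h1 h2 => [X Y|X]; first by rewrite !comp_lfunE h1 h2.
by rewrite !comp_lfunE h2 h1.
Qed.

Lemma preserves_inv phi : invertible phi ->
  preserves s Js phi -> preserves s Js (phi^-1)%VF.
Proof.
move=> phii hphi J JJ; move: (hphi J JJ).
case: ifP => _ h => [X Y|X]; first by rewrite -h !invertibleVK.
by rewrite -{1}[X](invertibleVK X phii) -h invertibleK.
Qed.

Lemma G_inv phi : G_ gamma phi -> G_ gamma (phi^-1)%VF.
Proof.
move=> /GP[i1 p1]; apply/GP.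
by split; [exact: invertible_inv|exact: preserves_inv].
Qed.

(* p_gamma; in the symplectic case its elements anticommute with [J]. *)
Definition p_alg (A : 'End(E)) : Prop :=
  symmetric_map ip A /\
  forall J, J \in Js -> forall X, A (J X) = (-1) ^+ s *: J (A X).

Lemma p_alg_linear : linear_pred p_alg.
Proof.
split; first by split=> [X Y|J _ X]; rewrite !zero_lfunE ?(inner0l Hip) ?(inner0r Hip) //
  linear0 scaler0.
move=> a A B [As AJ] [Bs BJ]; split=> [X Y|J JJ X].
  by rewrite !(add_lfunE, scale_lfunE) (innerDl Hip) (innerDr Hip) (innerZl Hip)
    (innerZr Hip) As Bs.
by rewrite !(add_lfunE, scale_lfunE) AJ // BJ // linearP scalerDr !scalerA mulrC.
Qed.

Section DiagonalElements.
Variables (k : nat) (f : 'I_k -> E).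
Hypothesis Hf : onb ip f.

Lemma p_alg_dgP a : p_alg (dg ip f a) <->
  forall J, J \in Js -> forall X,
    J (dg ip f a X) = dg ip f ((fun x => (-1) ^+ s * x) \o a) (J X).
Proof.
have E1 X : dg ip f ((fun x => (-1) ^+ s * x) \o a) X = (-1) ^+ s *: dg ip f a X.
  by apply: (onb_ext Hf) => i; rewrite (innerZl Hip) !dg_coord //= mulrA.
split=> [[_ AJ] J JJ X|h].
  by rewrite E1 AJ // scalerA -signr_addb addbb scale1r.
split=> [X Y|J JJ X]; first exact: dg_sym.
by rewrite h // E1 scalerA -signr_addb addbb scale1r.
Qed.

(** Group counterpart of the sign in [p_alg]: in the symplectic case J exchanges the eigenspaces of
    x and 1/x. *)
Definition inv_if (x : R) := if s then x^-1 else x.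

Lemma preserves_dgP d : (forall i, d i != 0) ->
  (preserves s Js (dg ip f d) <->
  forall J, J \in Js -> forall X, J (dg ip f d X) = dg ip f (inv_if \o d) (J X)).
Proof.
rewrite /preserves /inv_if => d0; split=> h J JJ; move: (h J JJ); case: ifP => _ {}h X //.
- apply: (onb_ext Hf) => i; rewrite dg_coord //=.
  have := h (f i) X; rewrite dg_onb // (innerZl Hip) => E1.
  by rewrite (innerC Hip) (innerC Hip _ (f i)) -E1 mulKf.
- move=> Y; rewrite h dg_sym; congr (ip X _).
  rewrite -[RHS](dg1 Hf) dg_dg //; apply: (onb_ext Hf) => i.
  by rewrite !dg_coord //= divff.
Qed.

(** Here and in the next two lemmas [dg_intertwine] passes a function through J: exp turns opposites
    into inverses, ln does the reverse, and the square root respects inverses. *)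
Lemma preserves_dg_exp a t : p_alg (dg ip f a) ->
  preserves s Js (dg ip f (fun i => expR (t * a i))).
Proof.
move=> /p_alg_dgP h; apply/preserves_dgP => [i|J JJ X].
  by rewrite gt_eqF ?expR_gt0.
rewrite (dg_intertwine Hf Hf (h J JJ) (fun x => expR (t * x))).
apply: (onb_ext Hf) => i; rewrite !dg_coord //=; congr (_ * _).
rewrite /inv_if; case: s; last by rewrite expr0 mul1r.
by rewrite expr1 mulN1r mulrN expRN.
Qed.

Lemma p_alg_dg_ln d : (forall i, 0 < d i) -> preserves s Js (dg ip f d) ->
  p_alg (dg ip f (fun i => ln (d i))).
Proof.
move=> dp /preserves_dgP h; apply/p_alg_dgP => J JJ X.
rewrite (dg_intertwine Hf Hf (h _ J JJ) (@ln R)) => [|i]; last by rewrite gt_eqF.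
apply: (onb_ext Hf) => i; rewrite !dg_coord //=; congr (_ * _).
rewrite /inv_if; case: s; last by rewrite expr0 mul1r.
by rewrite expr1 mulN1r lnV // posrE.
Qed.

Lemma preserves_dg_sqrt d : (forall i, 0 < d i) -> preserves s Js (dg ip f d) ->
  preserves s Js (dg ip f (fun i => Num.sqrt (d i))).
Proof.
move=> dp /preserves_dgP h; apply/preserves_dgP => [i|J JJ X].
  by rewrite gt_eqF // sqrtr_gt0.
rewrite (dg_intertwine Hf Hf (h _ J JJ) Num.sqrt) => [|i]; last by rewrite gt_eqF.
apply: (onb_ext Hf) => i; rewrite !dg_coord //=; congr (_ * _).
by rewrite /inv_if; case: s => //; rewrite sqrtrV // ltW.
Qed.

End DiagonalElements.

(** One direction differentiates at 0 the invariance under the one-parameter group; the other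
    diagonalizes [A] and exponentiates its eigenvalues. *)
Lemma p_P A : p_ ip gamma A <-> p_alg A.
Proof.
split=> [[[c [cG cD cA]] As]|[As AJ]].
  split=> // J JJ; have [Jsk J2] := HJ JJ.
  have c0 x : c 0 x = x.
    have /GP[ci _] := cG 0; have := cD 0 0; rewrite addr0 => h.
    have := congr1 (fun g : 'End(E) => (c 0)^-1%VF (g x)) h.
    by rewrite comp_lfunE !invertibleK.
  case Es: s => X; last first.
    rewrite expr0 scale1r; apply: (inner_ext Hip) => Z.
    apply: (is_derive_unique (cA (J X) Z)).
    have -> : (fun t => ip (c t (J X)) Z) = - (fun t => ip (c t X) (J Z)).
      apply/funext => t; have /GP[_ /(_ J JJ)] := cG t; rewrite Es => ->.
      by rewrite Jsk.
    rewrite Jsk; apply: is_deriveN; exact: cA.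
  rewrite expr1 scaleN1r; apply: (inner_ext Hip) => Z.
  rewrite (innerNl Hip) Jsk opprK As.
  have cN t x : c t (c (- t) x) = x.
    by rewrite -comp_lfunE -cD subrr c0.
  (* The symplectic form at [c t X] and [Z] is differentiated directly, and again after moving [c t]
     to the other argument as [c (- t)]; the two values must agree. *)
  have d1 : is_derive (0 : R) (1 : R) (fun t => ip (c t X) (J Z)) (ip (A X) (J Z)).
    exact: cA.
  have d2 : is_derive (0 : R) (1 : R) (fun t => ip (c t X) (J Z)) (ip (J X) (A Z)).
    have -> : (fun t => ip (c t X) (J Z)) = (fun t => - ip (c (- t) Z) (J X)).
      apply/funext => t; have /GP[_ /(_ J JJ)] := cG t; rewrite Es => ct.
      by rewrite -{1}[Z](cN t) ct (innerC Hip _ (J X)) Jsk opprK.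
    have d3 : is_derive (0 : R) (1 : R) (fun t => ip (c (- t) Z) (J X)) (- ip (A Z) (J X)).
      have dN : is_derive (0 : R) (1 : R) (-%R : R -> R) (-1).
        by apply: is_deriveN.
      have dA : is_derive (- 0 : R) (1 : R) (fun t => ip (c t Z) (J X)) (ip (A Z) (J X)).
        by rewrite oppr0; exact: cA.
      have := @is_derive1_comp R (fun t => ip (c t Z) (J X)) -%R 0 _ _ dA dN.
      by rewrite mulrN1.
    rewrite (innerC Hip (J X)) -[ip (A Z) _]opprK; exact: is_deriveN.
  exact: (is_derive_unique d2 d1).
have [k [f [a [Hf Af]]]] := symmetric_onb Hip As.
have EA := dg_unique Hf Af.
have pa : p_alg (dg ip f a) by rewrite -EA.
pose c (t : R) := dg ip f (fun i => expR (t * a i)).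
have cD t u x : c (t + u) x = c t (c u x).
  rewrite /c dg_dg //; apply: (onb_ext Hf) => i.
  by rewrite !dg_coord // mulrDl expRD.
split=> //; exists c; split.
- move=> t; apply/GP; split; last exact: preserves_dg_exp.
  apply: (@invertibleP _ (c (- t))) => x; rewrite -cD addNr.
  rewrite -[RHS](dg1 Hf); apply: (onb_ext Hf) => i.
  by rewrite !dg_coord // mul0r expR0.
- by move=> t u; apply/lfunP => x; rewrite comp_lfunE cD.
move=> X Y.
have -> : (fun t => ip (c t X) Y) =
    (fun t => \sum_i expR (t * a i) * (ip X (f i) * ip Y (f i))).
  by apply/funext => t; rewrite dg_ip; apply: eq_bigr => i _; rewrite mulrA.
rewrite EA dg_ip; apply: is_derive_bigsum => i.
have de := is_derive_expR_lin (a i).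
have -> : (fun t => expR (t * a i) * (ip X (f i) * ip Y (f i))) =
    (ip X (f i) * ip Y (f i)) \*: (fun t : R => expR (t * a i)).
  by apply/funext => t; rewrite mulrC.
apply: is_derive_eq; rewrite /GRing.scale /=; ring.
Qed.

End Structures.

(** * First-order conditions *)

Section Bracket.
Variables (R : realType) (E : vectType R) (ip : {dot E for idfun}).
Notation Hip := (ip_inner ip).
Variables (k : nat) (f : 'I_k -> E).
Hypothesis Hf : onb ip f.

Implicit Types mu la : bilin E.

Lemma ip_coord3 mu X Y Z : ip (mu X Y) Z =
  \sum_(I : 'I_k * 'I_k * 'I_k)
    ip X (f I.1.1) * ip Y (f I.1.2) * ip Z (f I.2) * coord3 ip f mu I.
Proof.
have [_ fs] := Hf.
rewrite -(sum3E (fun i j l => ip X (f i) * ip Y (f j) * ip Z (f l) * coord3 ip f mu (i, j, l))).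
rewrite {1}[X]fs linear_sum sum_lfunE (inner_suml Hip); apply: eq_bigr => i _.
rewrite linearZ /= scale_lfunE (innerZl Hip) {1}[Y]fs linear_sum (inner_suml Hip).
rewrite big_distrr; apply: eq_bigr => j _ /=.
rewrite linearZ /= (innerZl Hip) {1}[Z]fs (inner_sumr Hip) !big_distrr.
by apply: eq_bigr => l _ /=; rewrite (innerZr Hip) !mulrA.
Qed.

Definition of_coord3 (y : 'I_k * 'I_k * 'I_k -> R) : bilin E :=
  lmap ip f (fun i => lmap ip f (fun j => \sum_l y (i, j, l) *: f l)).

Lemma of_coord3K y I : coord3 ip f (of_coord3 y) I = y I.
Proof.
case: I => -[i j] l; rewrite /coord3 /of_coord3 /= !(lmap_onb Hip Hf).
have [of_ _] := Hf.
rewrite (inner_suml Hip) (bigD1 l) //= big1 => [|l' ll].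
  by rewrite (innerZl Hip) of_ eqxx mulr1 addr0.
by rewrite (innerZl Hip) of_ (negbTE ll) mulr0.
Qed.

Lemma skew_coord3 mu :
  (forall i j l, coord3 ip f mu (i, j, l) = - coord3 ip f mu (j, i, l)) ->
  skew_bilin mu.
Proof.
move=> h X Y; apply: (inner_ext Hip) => Z.
rewrite (innerNl Hip) !ip_coord3.
rewrite -(sum3E (fun i j l => ip X (f i) * ip Y (f j) * ip Z (f l) * coord3 ip f mu (i, j, l))).
rewrite -(sum3E (fun i j l => ip Y (f i) * ip X (f j) * ip Z (f l) * coord3 ip f mu (i, j, l))).
rewrite exchange_big -sumrN; apply: eq_bigr => i _; rewrite -sumrN.
apply: eq_bigr => j _; rewrite -sumrN; apply: eq_bigr => l _.
by rewrite h mulrN [ip X _ * _]mulrC.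
Qed.

Lemma coord3_skew mu i j l : skew_bilin mu ->
  coord3 ip f mu (i, j, l) = - coord3 ip f mu (j, i, l).
Proof. by move=> smu; rewrite /coord3 /= smu (innerNl Hip). Qed.

Lemma coord3_line mu la t I :
  coord3 ip f (mu + t *: la) I = coord3 ip f mu I + t * coord3 ip f la I.
Proof.
by rewrite /coord3 !(add_lfunE, scale_lfunE) (innerDl Hip) (innerZl Hip).
Qed.

Lemma coord3_scale mu t I : coord3 ip f (t *: mu) I = t * coord3 ip f mu I.
Proof. by rewrite /coord3 !scale_lfunE (innerZl Hip). Qed.

Lemma act_skew g (mu : bilin E) : skew_bilin mu -> skew_bilin (act g mu).
Proof. by move=> smu X Y; rewrite !actE smu linearN. Qed.

Lemma act_act g h (mu : bilin E) : invertible g -> invertible h ->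
  act (g \o h)%VF mu = act g (act h mu).
Proof.
move=> gi hi.
have E1 : ((g \o h)^-1 = h^-1 \o g^-1)%VF.
  by apply: inv_unique => x; rewrite !comp_lfunE !invertibleK.
apply/lfunP => X; apply/lfunP => Y.
by rewrite !actE E1 !comp_lfunE.
Qed.

Lemma act_invK g (mu : bilin E) : invertible g -> act (g^-1)%VF (act g mu) = mu.
Proof.
move=> gi; have E1 : ((g^-1)^-1 = g)%VF.
  by apply: inv_unique => x; exact: invertibleVK.
by apply/lfunP => X; apply/lfunP => Y; rewrite !actE E1 !invertibleK.
Qed.

Lemma act_neq0 g (mu : bilin E) : invertible g -> mu != 0 -> act g mu != 0.
Proof.
move=> gi; apply: contraNneq => h; apply/eqP.
rewrite -(act_invK mu gi) h; apply/lfunP => X; apply/lfunP => Y.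
by rewrite actE !zero_lfunE linear0.
Qed.

Lemma dg_inv d : (forall i, d i != 0) ->
  ((dg ip f d)^-1)%VF = dg ip f (fun i => (d i)^-1).
Proof.
move=> d0; apply: inv_unique => x; rewrite dg_dg // -[RHS](dg1 Hf).
by apply: (onb_ext Hf) => i; rewrite !dg_coord // mulVf.
Qed.

Lemma dg_invertible d : (forall i, d i != 0) -> invertible (dg ip f d).
Proof.
move=> d0; apply: (@invertibleP _ _ _ (dg ip f (fun i => (d i)^-1))) => x.
rewrite dg_dg // -[RHS](dg1 Hf).
by apply: (onb_ext Hf) => i; rewrite !dg_coord // mulVf.
Qed.

Lemma coord3_act_dg d mu I : (forall i, d i != 0) ->
  coord3 ip f (act (dg ip f d) mu) I =
  d I.2 / d I.1.1 / d I.1.2 * coord3 ip f mu I.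
Proof.
move=> d0; rewrite /coord3 actE dg_inv // !dg_onb // dg_coord // !linearZ /=.
by rewrite scale_lfunE !(innerZl Hip); ring.
Qed.

End Bracket.

(** * The gradient of F and its eigenvalue equation *)

Section MomentMap.
Variables (R : realType) (E : vectType R) (ip : {dot E for idfun}).
Notation Hip := (ip_inner ip).
Variables (n : nat) (e : n.-tuple E).
Hypothesis he : orthonormal_basis ip e.
Variables (gamma : tensors E) (s : bool) (Js : seq 'End(E)).
Hypothesis HJ : forall J, J \in Js -> compatible_structure ip J.
Hypothesis HG : forall phi, invertible phi -> (fixes phi gamma <-> preserves ip s Js phi).

Notation Hhs := (hs_inner he).
Notation Rg := (Ric_ ip e gamma).
Notation F := (F_ ip e gamma).
Notation sqn mu := (ip_bilin ip e mu mu).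
Notation p_alg := (p_alg ip s Js).

Implicit Types mu la : bilin E.

(** [proj_p] selects its value with [xget], so a projection must be shown to exist. [ortho_proj] for
    [hs] gives one, since [Ric - P] is symmetric and the traces are [hs] products. *)
Lemma Ric_projP mu : p_alg (Rg mu) /\
  forall A, p_alg A -> hs ip e (Rg mu) A = hs ip e (Ric ip e mu) A.
Proof.
have pP A := p_P HJ HG A.
have [P pP0 hP] := ortho_proj Hhs (Ric ip e mu) (p_alg_linear ip s Js).
have hsB (S P' A : 'End(E)) : hs ip e (S - P') A = 0 -> hs ip e P' A = hs ip e S A.
  by rewrite (innerBl Hhs) => /eqP; rewrite subr_eq0 => /eqP.
have symB (P' : 'End(E)) : symmetric_map ip P' -> symmetric_map ip (Ric ip e mu - P').
  move=> sP X Y; rewrite !(add_lfunE, opp_lfunE) (innerBl Hip) (innerBr Hip).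
  by rewrite sP Ric_sym.
have ex : exists P', [set P' : 'End(E) | p_ ip gamma P' /\
    forall A, p_ ip gamma A -> trace ip e ((Ric ip e mu - P') \o A)%VF = 0]%classic P'.
  exists P; split; first exact/pP.
  move=> A /pP pA; rewrite trace_hs; first exact: hP.
  by apply: symB; case: pP0.
have [/pP h1 h2] := xgetPex 0 ex.
split=> // A pA; apply: hsB; rewrite -trace_hs; first exact/h2/pP.
by apply: symB; case: h1.
Qed.

Definition moment_sqr (mu : bilin E) : R := hs ip e (Rg mu) (Rg mu).
Notation N := moment_sqr.

(** A basis of p_gamma that does not depend on [mu] makes [N] a sum of squares of quadratic
    functions of [mu], whence its differentiability. *)
Lemma Ric_proj_basis : exists m (B : 'I_m -> 'End(E)),
  [/\ forall r, p_alg (B r),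
      forall mu, Rg mu = \sum_r hs ip e (Ric ip e mu) (B r) *: B r &
      forall mu, N mu = \sum_r hs ip e (Ric ip e mu) (B r) ^+ 2].
Proof.
have [m [B [oB pB Bs]]] := linear_pred_onb Hhs (p_alg_linear ip s Js).
have RB mu : Rg mu = \sum_r hs ip e (Ric ip e mu) (B r) *: B r.
  have [h1 h2] := Ric_projP mu.
  by rewrite {1}[Rg mu]Bs //; apply: eq_bigr => r _; rewrite h2.
exists m, B; split => // mu.
have [h1 h2] := Ric_projP mu.
rewrite /N {2}RB (inner_sumr Hhs); apply: eq_bigr => r _.
by rewrite (innerZr Hhs) h2.
Qed.

Lemma hs_Ric_scale c mu B : hs ip e (Ric ip e (c *: mu)) B = c ^+ 2 * hs ip e (Ric ip e mu) B.
Proof.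
rewrite /hs big_distrr; apply: eq_bigr => i _ /=; rewrite !RicE // /ric_form mulrDr.
rewrite ![c ^+ 2 * (_ * _)]mulrCA; congr (_ * _ + _ * _);
  rewrite big_distrr; apply: eq_bigr => j _ /=; rewrite big_distrr;
  apply: eq_bigr => l _ /=; rewrite !scale_lfunE !(innerZl Hip); ring.
Qed.

Lemma sqnE k (f : 'I_k -> E) mu : onb ip f ->
  sqn mu = \sum_I coord3 ip f mu I ^+ 2.
Proof. by move=> Hf; rewrite (ip_bilinE he _ _ Hf); apply: eq_bigr => I _; rewrite expr2. Qed.

Lemma sqn_ge0 mu : 0 <= sqn mu.
Proof.
rewrite (sqnE _ (orthonormal_basis_onb he)).
by apply: sumr_ge0 => I _; exact: sqr_ge0.
Qed.

Lemma sqn_gt0 mu : mu != 0 -> 0 < sqn mu.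
Proof.
move=> mu0; rewrite lt_neqAle sqn_ge0 andbT eq_sym.
rewrite (sqnE _ (orthonormal_basis_onb he)).
rewrite psumr_eq0 => [|I _]; last exact: sqr_ge0.
apply: contra mu0 => /allP h; apply/eqP.
apply: (coord3_ext (orthonormal_basis_onb he)) => I.
have := h I (mem_index_enum I); rewrite /= sqrf_eq0 => /eqP ->.
by rewrite /coord3 !zero_lfunE (inner0l Hip).
Qed.

(** For nonzero [mu] the representative [vpick] is an unknown nonzero multiple of [mu]; numerator
    and denominator both scale by the fourth power of the factor. *)
Lemma F_line mu : F <[mu]>%VS = N mu / sqn mu ^+ 2.
Proof.
have N4 (nu : bilin E) : norm_bilin ip e nu ^+ 4 = sqn nu ^+ 2.
  by rewrite /norm_bilin (exprM _ 2 2) sqr_sqrtr // sqn_ge0.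
have symR nu : symmetric_map ip (Rg nu) by have [[]] := Ric_projP nu.
rewrite /F_ /= trace_hs // N4 -/(N _).
have [c Ec] : exists c, vpick <[mu]>%VS = c *: mu by apply/vlineP/memv_pick.
rewrite Ec; have [->|mu0] := eqVneq mu 0; first by rewrite scaler0.
have c0 : c != 0.
  apply: contraNneq mu0 => c0; move: (vpick0 <[mu]>%VS).
  by rewrite Ec c0 scale0r eqxx -memv0 => /esym/eqP h; rewrite -h memv_line.
have [m [B [_ _ NB]]] := Ric_proj_basis.
have -> : N (c *: mu) = c ^+ 4 * N mu.
  rewrite !NB big_distrr; apply: eq_bigr => r _ /=.
  by rewrite hs_Ric_scale; ring.
have -> : sqn (c *: mu) = c ^+ 2 * sqn mu.
  rewrite !(sqnE _ (orthonormal_basis_onb he)) big_distrr; apply: eq_bigr => I _ /=.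
  by rewrite coord3_scale exprMn.
have q0 := sqn_gt0 mu0.
by field; rewrite c0 gt_eqF.
Qed.

Section Eigenbasis.
Variables (k : nat) (f : 'I_k -> E) (a : 'I_k -> R) (mu : bilin E).
Hypotheses (Hf : onb ip f) (smu : skew_bilin mu) (mu0 : mu != 0).
Hypothesis Ra : Rg mu = dg ip f a.

Lemma moment_sqrE : 4 * N mu = \sum_I weight a I * coord3 ip f mu I ^+ 2.
Proof.
have [pR hR] := Ric_projP mu; have := hR _ pR.
by rewrite -/(N mu) => ->; rewrite Ra (hs_Ric_dg he).
Qed.

(** The derivative at 0 of the sum of [rho r t ^+ 2] is twice that of the sum of
    [rho r 0 * rho r t], the [hs] product of [Ric (m t)] with the fixed operator [Rg mu]. It is read
    off in the eigenbasis at [mu], so no eigenbasis has to be followed along the curve. *)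
Lemma is_derive_F (m : R -> bilin E) (y : 'I_k * 'I_k * 'I_k -> R) :
  m 0 = mu -> (forall t, skew_bilin (m t)) ->
  (forall I, is_derive (0 : R) (1 : R) (fun t => coord3 ip f (m t) I) (y I)) ->
  is_derive (0 : R) (1 : R) (fun t => F <[m t]>%VS)
    ((\sum_I (weight a I - 4 * N mu / sqn mu) * coord3 ip f mu I * y I) / sqn mu ^+ 2).
Proof.
move=> m0 sm dm.
have [l [B [pB RB NB]]] := Ric_proj_basis.
pose rho r t := hs ip e (Ric ip e (m t)) (B r).
have dcoord l' (f' : 'I_l' -> E) I : exists d : R,
    is_derive (0 : R) (1 : R) (fun t => coord3 ip f' (m t) I) d.
  eexists; rewrite /coord3.
  have -> : (fun t => ip (m t (f' I.1.1) (f' I.1.2)) (f' I.2)) =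
     (fun t => \sum_(L : 'I_k * 'I_k * 'I_k)
     ip (f' I.1.1) (f L.1.1) * ip (f' I.1.2) (f L.1.2) * ip (f' I.2) (f L.2) * coord3 ip f (m t) L).
    by apply/funext => t; rewrite (ip_coord3 Hf).
  by apply: is_derive_bigsum => L; exact: is_derive_scal.
have drho r : exists d : R, is_derive (0 : R) (1 : R) (rho r) d.
  have [Bs _] := pB r; have [l' [f' [b [Hf' Bf]]]] := symmetric_onb Hip Bs.
  have [d dd] := choice (dcoord l' f').
  eexists; have -> : rho r = (fun t => \sum_I (weight b I / 4) * coord3 ip f' (m t) I ^+ 2).
    apply/funext => t; rewrite /rho (dg_unique Hf' Bf).
    have := hs_Ric_dg he b Hf' (sm t) => h.
    apply: (mulfI (x := 4)); first by rewrite pnatr_eq0.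
    rewrite h big_distrr; apply: eq_bigr => I _ /=; by field.
  by apply: is_derive_bigsum => I; apply: is_derive_scal; exact: is_derive_sqr.
have [drh Drh] := choice drho.
pose xy := \sum_I coord3 ip f mu I * y I.
pose wxy := \sum_I weight a I * coord3 ip f mu I * y I.
have dN : is_derive (0 : R) (1 : R) (fun t => N (m t)) wxy.
  have -> : (fun t => N (m t)) = (fun t => \sum_r rho r t ^+ 2).
    by apply/funext => t; rewrite NB.
  have H := is_derive_bigsum (index_enum _) (fun r => is_derive_sqr (Drh r)).
  apply: (is_derive_eq H).
  have h1 : is_derive (0 : R) (1 : R) (fun t => \sum_r rho r 0 * rho r t)
     (\sum_r rho r 0 * drh r).
    by apply: is_derive_bigsum => r; exact: is_derive_scal.
  have h2 : is_derive (0 : R) (1 : R) (fun t => \sum_r rho r 0 * rho r t)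
     (\sum_I (weight a I / 4) * (2 * coord3 ip f mu I * y I)).
    have -> : (fun t => \sum_r rho r 0 * rho r t) =
        (fun t => \sum_I (weight a I / 4) * coord3 ip f (m t) I ^+ 2).
      apply/funext => t; transitivity (hs ip e (Ric ip e (m t)) (Rg (m 0))).
        by rewrite RB (inner_sumr Hhs); apply: eq_bigr => r _; rewrite (innerZr Hhs).
      rewrite m0 Ra; apply: (mulfI (x := 4)); first by rewrite pnatr_eq0.
      rewrite (hs_Ric_dg he) // big_distrr; apply: eq_bigr => I _ /=; by field.
    rewrite -m0; apply: is_derive_bigsum => I; apply: is_derive_scal.
    exact: is_derive_sqr.
  have h3 := is_derive_unique h1 h2.
  transitivity (2 * \sum_r rho r 0 * drh r).
    by rewrite big_distrr; apply: eq_bigr => r _ /=; rewrite mulrA.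
  rewrite h3 big_distrr; apply: eq_bigr => I _ /=; by field.
have dq : is_derive (0 : R) (1 : R) (fun t => sqn (m t)) (2 * xy).
  have -> : (fun t => sqn (m t)) = (fun t => \sum_I coord3 ip f (m t) I ^+ 2).
    by apply/funext => t; rewrite (sqnE _ Hf).
  have H := is_derive_bigsum (index_enum _) (fun I => is_derive_sqr (dm I)).
  apply: (is_derive_eq H).
  by rewrite /xy big_distrr m0; apply: eq_bigr => I _ /=; rewrite mulrA.
have q0 : sqn mu != 0 by rewrite gt_eqF // sqn_gt0.
have -> : (fun t => F <[m t]>%VS) = (fun t => N (m t) / sqn (m t) ^+ 2).
  by apply/funext => t; rewrite F_line.
have q0' : sqn (m 0) != 0 by rewrite m0.
apply: (is_derive_eq (is_derive_ratio q0' dN dq)).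
rewrite m0.
have -> : \sum_I (weight a I - 4 * N mu / sqn mu) * coord3 ip f mu I * y I =
    wxy - 4 * N mu / sqn mu * xy.
  rewrite /wxy /xy mulr_sumr -sumrB; apply: eq_bigr => I _ /=.
  by rewrite !mulrBl !mulrA.
by field.
Qed.

(* The first-order condition shared by the three characterizations: [mu] is an
   eigenvector of [pi(Ric^gamma_mu)], the coordinates with respect to an eigenbasis
   of [Ric^gamma_mu] being eigenvectors for [pi]. *)
Definition moment_eigen (c : R) : Prop :=
  forall I, weight a I * coord3 ip f mu I = c * coord3 ip f mu I.

Lemma moment_eigen_value c : moment_eigen c -> 4 * N mu = c * sqn mu.
Proof.
move=> h; rewrite moment_sqrE (sqnE _ Hf) big_distrr; apply: eq_bigr => I _ /=.
by rewrite !expr2 !mulrA h.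
Qed.

Lemma moment_eigenP c :
  \sum_I ((weight a I - c) * coord3 ip f mu I) ^+ 2 = 0 -> moment_eigen c.
Proof.
move=> /eqP; rewrite psumr_eq0 => [/allP h I|I _]; last exact: sqr_ge0.
have := h I (mem_index_enum I); rewrite /= sqrf_eq0 mulrBl subr_eq0.
by move/eqP.
Qed.

Lemma critical_eigen : critical_point F mu <-> exists c, moment_eigen c.
Proof.
have q0 : sqn mu != 0 by rewrite gt_eqF // sqn_gt0.
have D la (sla : skew_bilin la) : is_derive (0 : R) (1 : R) (fun t => F <[mu + t *: la]>%VS)
    ((\sum_I (weight a I - 4 * N mu / sqn mu) * coord3 ip f mu I * coord3 ip f la I) / sqn mu ^+ 2).
  apply: is_derive_F; first by rewrite scale0r addr0.
    move=> t X Y; rewrite !(add_lfunE, scale_lfunE) smu sla.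
    by rewrite scalerN opprD.
  move=> I; have -> : (fun t : R => coord3 ip f (mu + t *: la) I) =
      cst (coord3 ip f mu I) + coord3 ip f la I \*: id.
    by apply/funext => t; rewrite coord3_line [t * _]mulrC.
  by apply: is_derive_eq; rewrite /GRing.scale /= mulr1 add0r.
split=> [crit|[c h] la sla].
  exists (4 * N mu / sqn mu).
  (* The test direction is the gradient itself, up to a factor; it is skew because [weight] is
     symmetric in the two inputs, and it turns the derivative into a sum of squares. *)
  pose y I := (weight a I - 4 * N mu / sqn mu) * coord3 ip f mu I.
  have sla : skew_bilin (of_coord3 ip f y).
    apply: (skew_coord3 Hf) => i j l; rewrite !(of_coord3K Hf) /y.
    by rewrite (coord3_skew ip f _ _ _ smu) /weight /=; ring.
  apply: moment_eigenP.
  have /eqP := is_derive_unique (D _ sla) (crit _ sla).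
  rewrite mulf_eq0 invr_eq0 expf_eq0 (negbTE q0) andbF orbF => /eqP h.
  rewrite -[RHS]h; apply: eq_bigr => I _.
  by rewrite (of_coord3K Hf) expr2.
apply: (is_derive_eq (D la sla)); rewrite big1 ?mul0r // => I _.
by rewrite (moment_eigen_value h) mulfK // mulrBl h subrr mul0r.
Qed.

(** pi(I) is -1 on bilinear maps, so pi(A - cI) kills [mu] exactly when pi(A) mu = -c mu; hence the
    opposite signs of the two constants. *)
Lemma derivation_eigen :
  (exists (c : R) (D : 'End(E)), is_derivation mu D /\ Rg mu = c *: \1%VF + D) <->
  exists c, moment_eigen c.
Proof.
split=> [[c [D [dD RD]]]|[c h]].
  have Df i : D (f i) = (a i - c) *: f i.
    have := congr1 (fun g : 'End(E) => g (f i)) RD.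
    rewrite Ra add_lfunE scale_lfunE id_lfunE dg_onb // => E1.
    by rewrite scalerBl E1 addrC addKr.
  exists (- c) => -[[i j] l].
  have := congr1 (fun x => ip x (f l)) (dD (f i) (f j)).
  rewrite (dg_unique Hf Df) dg_sym !dg_onb // !linearZ /= scale_lfunE.
  rewrite (innerDl Hip) !(innerZl Hip) /weight /coord3 /=.
  by rewrite /=; set x := ip _ _ => h; lra.
pose D := dg ip f (fun i => a i + c); exists (- c), D; split; last first.
  rewrite Ra; apply: (lfun_onb Hf) => i.
  rewrite add_lfunE scale_lfunE id_lfunE /D !dg_onb // -scalerDl.
  by congr (_ *: _); ring.
move=> X Y; apply: (inner_ext Hip) => Z.
rewrite dg_sym (innerDl Hip) !(ip_coord3 Hf) -big_split; apply: eq_bigr => I _ /=.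
rewrite !dg_coord //; have := h I; rewrite /weight.
move: (coord3 _ _ _ _) => x hx.
have -> : (a I.2 + c) * ip Z (f I.2) = (a I.2 - a I.1.1 - a I.1.2 - c) * ip Z (f I.2)
   + (a I.1.1 + a I.1.2 + 2 * c) * ip Z (f I.2) by ring.
rewrite mulrDr mulrDl.
have -> : ip X (f I.1.1) * ip Y (f I.1.2) * ((a I.2 - a I.1.1 - a I.1.2 - c) * ip Z (f I.2)) * x
  = ip X (f I.1.1) * ip Y (f I.1.2) * ip Z (f I.2) * ((a I.2 - a I.1.1 - a I.1.2) * x - c * x) by ring.
by rewrite hx; ring.
Qed.

Lemma orbit_min_eigen :
  (forall g, G_ gamma g -> F <[mu]>%VS <= F <[act g mu]>%VS) ->
  exists c, moment_eigen c.
Proof.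
move=> hmin; have q0 : sqn mu != 0 by rewrite gt_eqF // sqn_gt0.
have [pR _] := Ric_projP mu.
pose d t i := expR (t * a i).
have d0 t i : d t i != 0 by rewrite gt_eqF ?expR_gt0.
pose m t := act (dg ip f (d t)) mu.
have m0 : m 0 = mu.
  apply: (coord3_ext Hf) => I; rewrite /m coord3_act_dg // /d !mul0r expR0.
  by rewrite !divr1 mul1r.
have Gd t : G_ gamma (dg ip f (d t)).
  apply/(GP HG); split; first exact: dg_invertible.
  by apply: preserves_dg_exp => //; rewrite -Ra.
have cm t I : coord3 ip f (m t) I = expR (t * weight a I) * coord3 ip f mu I.
  rewrite /m coord3_act_dg // /d /weight !mulrBr !expRD !expRN.
  by congr (_ * _).
have dm I : is_derive (0 : R) (1 : R) (fun t => coord3 ip f (m t) I)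
    (weight a I * coord3 ip f mu I).
  have -> : (fun t => coord3 ip f (m t) I) = (fun t => coord3 ip f mu I * expR (t * weight a I)).
    by apply/funext => t; rewrite cm mulrC.
  rewrite mulrC; apply: is_derive_scal; exact: is_derive_expR_lin.
have := is_derive_F m0 (fun t => act_skew (dg ip f (d t)) smu) dm.
move=> /is_derive_at_min /(_ _)/eqP; rewrite m0 => /(_ (fun t => hmin _ (Gd t))).
rewrite mulf_eq0 invr_eq0 expf_eq0 (negbTE q0) andbF orbF => /eqP h.
(* This constant is the mean of the weights for the masses [coord3 ip f mu I ^+ 2]; the derivative
   of F along exp(tA) mu is their variance up to a positive factor. *)
exists (4 * N mu / sqn mu); apply: moment_eigenP.
set c := 4 * N mu / sqn mu in h *.
have Ec : \sum_I weight a I * coord3 ip f mu I ^+ 2 = c * \sum_I coord3 ip f mu I ^+ 2.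
  by rewrite -moment_sqrE -(sqnE _ Hf) /c divfK.
transitivity (\sum_I (weight a I - c) * coord3 ip f mu I * (weight a I * coord3 ip f mu I)
  - c * (\sum_I weight a I * coord3 ip f mu I ^+ 2 - c * \sum_I coord3 ip f mu I ^+ 2)).
  rewrite mulr_sumr -sumrB mulr_sumr -sumrB; apply: eq_bigr => I _ /=; ring.
by rewrite h Ec subrr mulr0 subrr.
Qed.

End Eigenbasis.

End MomentMap.

(** * Parabolic decomposition *)

Section BlockPolar.
Variables (R : realType) (E : vectType R) (ip : {dot E for idfun}).
Notation Hip := (ip_inner ip).
Variables (s : bool) (Js : seq 'End(E)).
Hypothesis HJ : forall J, J \in Js -> compatible_structure ip J.
Variables (k : nat) (f : 'I_k -> E) (a : 'I_k -> R).
Hypothesis Hf : onb ip f.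

(** Identity plus terms that strictly raise the eigenvalue of [dg ip f a]. Comparing eigenvalues
    rather than indices gives identity blocks on whole eigenspaces. *)
Definition unipotent (u : 'End(E)) : Prop :=
  forall i j, a i <= a j -> ip (u (f j)) (f i) = (i == j)%:R.

Lemma lfun_expand (h : 'End(E)) x : h x = \sum_j ip x (f j) *: h (f j).
Proof.
have [_ fs] := Hf; rewrite {1}[x]fs linear_sum.
by apply: eq_bigr => j _; rewrite linearZ.
Qed.

Lemma lfun_coord (u : 'End(E)) x i :
  ip (u x) (f i) = \sum_j ip x (f j) * ip (u (f j)) (f i).
Proof.
rewrite lfun_expand (inner_suml Hip).
by apply: eq_bigr => j _; rewrite (innerZl Hip).
Qed.

Lemma unipotent_coord u x i : unipotent u ->
  (forall j, ip x (f j) != 0 -> a i <= a j) -> ip (u x) (f i) = ip x (f i).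
Proof.
move=> uu hx; rewrite lfun_coord (bigD1 i) //= big1 => [|j ji].
  by rewrite uu // eqxx mulr1 addr0.
have [->|/hx aij] := eqVneq (ip x (f j)) 0; first by rewrite mul0r.
by rewrite uu // eq_sym (negbTE ji) mulr0.
Qed.

Lemma unipotent_gt u alpha z : unipotent u ->
  (forall i, a i <= alpha -> ip (u z) (f i) = 0) ->
  forall i, a i <= alpha -> ip z (f i) = 0.
Proof.
move=> uu huz i ai; apply/eqP/negPn/negP => zi.
pose P l := ip z (f l) != 0.
case: (@Order.TotalTheory.arg_minP _ R _ i P a zi) => m Pm mmin.
have := huz m (le_trans (mmin _ zi) ai).
rewrite unipotent_coord // => /eqP; exact/negP.
Qed.

Lemma unipotent_invertible u : unipotent u -> invertible u.
Proof.
move=> uu; apply/eqP; rewrite -subv0; apply/subvP => z.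
rewrite memv_ker memv0 => /eqP uz; apply/eqP/(onb_ext Hf) => i.
rewrite (inner0l Hip); apply: (unipotent_gt (alpha := a i) uu) => // j _.
by rewrite uz (inner0l Hip).
Qed.

Lemma unipotent_inv u : unipotent u -> unipotent (u^-1)%VF.
Proof.
move=> uu i j aij; have ui := unipotent_invertible uu; have [of_ _] := Hf.
have h l : a l <= a j -> ip ((u^-1)%VF (f j) - f j) (f l) = 0.
  apply: (unipotent_gt uu) => m am.
  by rewrite linearB /= invertibleVK // (innerBl Hip) uu // of_ eq_sym subrr.
have /eqP := h i aij; rewrite (innerBl Hip) subr_eq0 => /eqP ->.
by rewrite of_ eq_sym.
Qed.

Section Element.
Variable g : 'End(E).
Hypotheses (gi : invertible g) (gp : preserves ip s Js g).
Hypothesis Ap : p_alg ip s Js (dg ip f a).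

(* Gram-Schmidt with respect to the pulled back inner product, blockwise along
   the flag of sums of eigenspaces. *)
Lemma block_orthogonalization : exists u, unipotent u /\
  forall i j, a j < a i -> ip (g (u (f j))) (g (f i)) = 0.
Proof.
have [of_ _] := Hf.
pose b x y := ip (g x) (g y).
have Hb : inner_product b.
  split=> [c x y z|x y|x x0]; rewrite /b.
  - by rewrite linearP (innerDl Hip) (innerZl Hip).
  - by rewrite (innerC Hip).
  apply: (inner_gt0 Hip); apply: contraNneq x0 => h.
  by rewrite -(invertibleK x gi) h linear0.
(* [Q j] is spanned by the [f i] of larger eigenvalue than [f j]. Subtracting from [f j] its
   [b]-projection there changes only higher terms, so the map obtained is unipotent. *)
pose Q j x := forall i, a i <= a j -> ip x (f i) = 0.
have lQ j : linear_pred (Q j).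
  split=> [i _|c x y Qx Qy i ai]; first exact: (inner0l Hip).
  by rewrite (innerDl Hip) (innerZl Hip) Qx // Qy // mulr0 addr0.
have ex j : exists w, Q j w /\ forall z, Q j z -> b (f j - w) z = 0.
  by have [w Qw wo] := ortho_proj Hb (f j) (lQ j); exists w.
have [w hw] := choice ex.
exists (lmap ip f (fun j => f j - w j)); split=> i j aij;
  rewrite (lmap_onb Hip Hf); have [Qw wo] := hw j.
  by rewrite (innerBl Hip) Qw // subr0 of_ eq_sym.
apply: wo => l al; rewrite of_; case: eqVneq => // il.
by move: aij; rewrite il ltNge al.
Qed.

Variable u : 'End(E).
Hypothesis uu : unipotent u.
Hypothesis uo : forall i j, a j < a i -> ip (g (u (f j))) (g (f i)) = 0.

Lemma block_orthogonal x y :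
  (forall i j, ip x (f j) != 0 -> ip y (f i) != 0 -> a j < a i) ->
  ip (g (u x)) (g y) = 0.
Proof.
move=> hxy; rewrite -[g (u x)]comp_lfunE lfun_expand (inner_suml Hip) big1 // => j _.
rewrite (lfun_expand g y) (inner_sumr Hip) big1 // => i _.
rewrite comp_lfunE !(innerZl Hip) !(innerZr Hip).
have [->|xj] := eqVneq (ip x (f j)) 0; first by rewrite mul0r.
have [->|yi] := eqVneq (ip y (f i)) 0; first by rewrite mul0r mulr0.
by rewrite uo ?mulr0 // hxy.
Qed.

Lemma structure_block J i j : J \in Js ->
  ip (J (f j)) (f i) != 0 -> a i = (-1) ^+ s * a j.
Proof.
move=> JJ; have [_ AJ] := Ap.
have := congr1 (fun x => ip x (f i)) (AJ J JJ (f j)).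
rewrite /= dg_coord // dg_onb // linearZ /= !(innerZl Hip) mulrA => /eqP.
rewrite -subr_eq0 -mulrBl mulf_eq0 subr_eq0 => /orP[/eqP //|/eqP ->].
by rewrite eqxx.
Qed.

(** When J commutes with [dg ip f a], this is uniqueness of the block orthogonalization, applied to
    [u] and its conjugate by J. In the symplectic case the form is checked on each pair of basis
    vectors. *)
Lemma block_preserves : preserves ip s Js (g \o u)%VF.
Proof.
move=> J JJ; have [Jsk J2] := HJ JJ; have [of_ fs] := Hf.
have Jsk' X Y : ip X (J Y) = - ip (J X) Y by rewrite Jsk opprK.
have SB := fun i j => @structure_block J i j JJ; move: (gp JJ) SB; case: ifP => _ gJ.
  rewrite expr1 => SB.
  have JE X Y : ip X (J Y) = \sum_l \sum_m ip X (f l) * ip Y (f m) * ip (f l) (J (f m)).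
    rewrite {1}[X]fs (inner_suml Hip); apply: eq_bigr => l _.
    rewrite (innerZl Hip) (lfun_expand J Y) (inner_sumr Hip) mulr_sumr.
    by apply: eq_bigr => m _; rewrite (innerZr Hip) mulrA.
  have key i j : ip (g (u (f j))) (J (g (u (f i)))) = ip (f j) (J (f i)).
    (* The form pairs only opposite eigenvalues and [u] only raises them, so for a nonnegative sum
       just the leading terms of [u (f j)] and [u (f i)] can pair. *)
    have [aij|aij] := leP 0 (a j + a i).
      rewrite gJ !JE; apply: eq_bigr => l _; apply: eq_bigr => m _.
      have [->|h] := eqVneq (ip (f l) (J (f m))) 0; first by rewrite !mulr0.
      congr (_ * _); have alm : a l = - a m.
        by rewrite -mulN1r; apply: SB; rewrite (innerC Hip).
      have [alj|alj] := leP (a l) (a j).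
        have [ami|ami] := leP (a m) (a i).
          by rewrite !uu // !of_ (eq_sym l) (eq_sym m).
        have lj : l == j = false by apply: contraTF ami => /eqP lj;
          rewrite -leNgt; rewrite lj in alm; lra.
        by rewrite uu // lj mul0r of_ eq_sym lj mul0r.
      have mi : m == i = false by apply: contraTF alj => /eqP mi;
          rewrite -leNgt; rewrite mi in alm; lra.
      have ami : a m <= a i by lra.
      by rewrite (uu ami) mi mulr0 !of_ (eq_sym i) mi mulr0.
    have SBij : ip (f j) (J (f i)) = 0.
      rewrite (innerC Hip); apply/eqP/negPn/negP => /SB h.
      by move: aij; rewrite h mulN1r addNr ltxx.
    rewrite SBij -[J _](invertibleVK _ gi).
    (* It suffices that [z] has only eigenvalues above [a j]. Up to sign, invariance of the form
       turns its component along [f l] into the product of [g (u (f i))] and [g (J (f l))]; if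
       [a l <= a j], then [J (f l)] has eigenvalue [- a l > a i]. *)
    set z := (g^-1)%VF _.
    apply: block_orthogonal => l m.
    rewrite of_; case: (eqVneq j m) => [<- _|_]; last by rewrite eqxx.
    move=> zl; rewrite ltNge; apply/negP => al; case/negP: zl; apply/eqP.
    have -> : ip z (f l) = - ip z (J (J (f l))) by rewrite J2 (innerNr Hip) opprK.
    rewrite -gJ /z invertibleVK // Jsk J2 (innerNr Hip) !opprK.
    apply/eqP; rewrite oppr_eq0; apply/eqP/block_orthogonal => p q.
    rewrite of_; case: (eqVneq i q) => [<- _|_]; last by rewrite eqxx.
    by move=> /SB ->; lra.
  move=> X Y; rewrite !comp_lfunE.
  have -> : ip X (J Y) = \sum_j ip X (f j) * ip (f j) (J Y).
    by rewrite {1}[X]fs (inner_suml Hip); apply: eq_bigr => j _; rewrite (innerZl Hip).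
  rewrite -[g (u X)]comp_lfunE (lfun_expand (g \o u)%VF X) (inner_suml Hip).
  apply: eq_bigr => j _; rewrite (innerZl Hip); congr (_ * _).
  have -> : J (g (u Y)) = (J \o (g \o u))%VF Y by rewrite !comp_lfunE.
  rewrite (lfun_expand (J \o _)%VF) (lfun_expand J).
  rewrite !(inner_sumr Hip); apply: eq_bigr => i _.
  by rewrite !(innerZr Hip) !comp_lfunE key.
rewrite expr0 => SB X; rewrite !comp_lfunE.
suff : (u \o J)%VF = (J \o u)%VF.
  by move=> /(congr1 (fun h : 'End(E) => h X)); rewrite !comp_lfunE => ->.
apply: (lfun_onb Hf) => j; rewrite !comp_lfunE; apply/eqP; rewrite -subr_eq0.
set d := _ - _.
(* The defect [d] lies in eigenspaces strictly above [f j]. Both parts of [g d] are orthogonal to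
   images of such vectors, hence [g d] is orthogonal to itself. *)
have dgt i : ip d (f i) != 0 -> a j < a i.
  move=> di; rewrite ltNge; apply/negP => aij; case/negP: di.
  rewrite /d (innerBl Hip) unipotent_coord // => [|l /SB]; last by rewrite mul1r => ->.
  rewrite !Jsk (innerC Hip (f j)) (innerC Hip (u _)) subr_eq0 eqr_opp.
  rewrite !(parseval Hip Hf (J (f i))); apply/eqP/eq_bigr => l _.
  have [->|/SB] := eqVneq (ip (J (f i)) (f l)) 0; first by rewrite !mul0r.
  by rewrite mul1r => ali; rewrite uu ?ali // of_ eq_sym.
have g0 : g d = 0.
  have Ed : g d = g (u (J (f j))) - g (J (u (f j))) by rewrite /d linearB.
  apply: (inner_eq0 Hip); rewrite {1}Ed (innerBl Hip).
  rewrite block_orthogonal ?sub0r; last first.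
    by move=> i l /SB; rewrite mul1r => -> /dgt.
  rewrite gJ Jsk -gJ block_orthogonal ?oppr0 // => i l.
  rewrite of_; case: (eqVneq j l) => [<- _|_]; last by rewrite eqxx.
  move=> Jdi; rewrite ltNge; apply/negP => aij; case/negP: Jdi.
  rewrite Jsk (parseval Hip Hf) oppr_eq0 big1 // => m _.
  have [->|/dgt am] := eqVneq (ip d (f m)) 0; first by rewrite mul0r.
  have [->|/SB] := eqVneq (ip (J (f i)) (f m)) 0; first by rewrite mulr0.
  by rewrite mul1r => ami; move: am; rewrite ami ltNge aij.
by rewrite -[d](invertibleK _ gi) g0 linear0.
Qed.

End Element.

(* The analogue of the decomposition G = K P for the parabolic subgroup P defined
   by a symmetric element [A = dg f a] of the Lie algebra. The Levi part of the
   factor in P is arranged to be positive symmetric, so that it lies in exp p. *)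
Lemma block_polar (g : 'End(E)) : invertible g -> preserves ip s Js g ->
  p_alg ip s Js (dg ip f a) ->
  exists (kk u w : 'End(E)) l (f' : 'I_l -> E) (d : 'I_l -> R),
    [/\ [/\ invertible kk, preserves ip s Js kk & orthogonal_map ip kk],
        [/\ onb ip f', forall i, 0 < d i & preserves ip s Js (dg ip f' d)],
        forall x, dg ip f a (dg ip f' d x) = dg ip f' d (dg ip f a x),
        [/\ invertible w, (w^-1)%VF = u, unipotent u & unipotent w] &
        g = (kk \o dg ip f' d \o w)%VF].
Proof.
move=> gi gp Ap; have [u [uu uo]] := block_orthogonalization gi.
have Tp := block_preserves gi gp Ap uu uo.
have ui := unipotent_invertible uu.
set T := (g \o u)%VF in Tp.
have Ti : invertible T by exact: invertible_comp.
(* Polar decomposition of [T]: H is the transpose of [T] times [T], the positive factor is its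
   square root, and [kk] is what remains. *)
have [H HE] : exists H : 'End(E), forall x y, ip (H x) y = ip (T x) (T y).
  by exists (adj ip f T \o T)%VF => x y; rewrite comp_lfunE adjE.
have Hs x y : ip (H x) y = ip x (H y) by rewrite (innerC Hip x) !HE (innerC Hip).
have [l [f' [h [Hf' hf]]]] := symmetric_onb Hip Hs.
have HD := dg_unique Hf' hf.
have h0 i : 0 < h i.
  have [of' _] := Hf'.
  have := HE (f' i) (f' i); rewrite hf (innerZl Hip) of' eqxx mulr1 => ->.
  apply: (inner_gt0 Hip); apply/negP => /eqP T0.
  have : f' i = 0 by rewrite -[f' i](invertibleK _ Ti) T0 linear0.
  move=> /(congr1 (fun x => ip x (f' i))); rewrite of' eqxx (inner0l Hip).
  by move/eqP; rewrite oner_eq0.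
have Hp : preserves ip s Js H.
  move=> J JJ; have [Jsk J2] := HJ JJ; move: (Tp J JJ).
  case: ifP => _ TJ => [X Y|X].
    (* The transpose of a symplectic map is again symplectic. *)
    have TJH : T (J (H Y)) = J (T Y).
      rewrite -[RHS](invertibleVK _ Ti); congr (T _); apply: (inner_ext Hip) => Z.
      have ZE W : ip W Z = - ip W (J (J Z)) by rewrite J2 (innerNr Hip) opprK.
      rewrite Jsk HE [RHS]ZE -TJ invertibleVK //.
      by rewrite Jsk J2 (innerNr Hip) opprK.
    by rewrite HE TJH TJ.
  apply: (inner_ext Hip) => Y.
  by rewrite HE TJ Jsk -TJ -HE -Jsk.
(* Different eigenspaces of [dg ip f a] have orthogonal images under [T], so H is block diagonal and
   the positive factor commutes with [dg ip f a]. *)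
have orth_T i j : a i < a j -> ip (T (f i)) (T (f j)) = 0.
  move=> aij; rewrite /T !comp_lfunE; apply: (block_orthogonal uo) => p q.
  have [of_ _] := Hf; rewrite of_; case: (eqVneq i q) => [<- _|_]; last by rewrite eqxx.
  apply: contraNT; rewrite -leNgt => api; have apj := le_lt_trans api aij.
  rewrite uu ?ltW //; case: (eqVneq p j) => [pj|_]; last by rewrite eqxx.
  by rewrite pj ltxx in apj.
have HA x : dg ip f a (H x) = H (dg ip f a x).
  rewrite -!comp_lfunE; congr (fun_of_lfun _ x); apply: (lfun_onb Hf) => j.
  rewrite !comp_lfunE; apply: (onb_ext Hf) => i.
  rewrite dg_coord // dg_onb //.
  have -> : H (a j *: f j) = a j *: H (f j) by rewrite linearZ.
  rewrite (innerZl Hip) HE.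
  case: (ltgtP (a i) (a j)) => [aij|aij|-> //].
    rewrite (innerC Hip) orth_T // !mulr0 //.
  by rewrite orth_T // !mulr0.
pose d i := Num.sqrt (h i).
have d0 i : 0 < d i by rewrite sqrtr_gt0.
have Sp : preserves ip s Js (dg ip f' d).
  by apply: preserves_dg_sqrt => //; rewrite -HD.
have d0' i : d i != 0 by rewrite gt_eqF.
have Si := dg_invertible Hf' d0'.
pose kk := (T \o (dg ip f' d)^-1)%VF.
exists kk, u, (u^-1)%VF, l, f', d; split.
- split; first exact/invertible_comp/invertible_inv.
    exact/preserves_comp/preserves_inv.
  have kkE x : kk x = T ((dg ip f' d)^-1%VF x) by rewrite /kk comp_lfunE.
  move=> X Y; rewrite !kkE -HE HD dg_inv // -dg_sym.
  rewrite !dg_dg // -[in RHS](dg1 Hf' X); congr (ip _ Y).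
  apply: (onb_ext Hf') => i; rewrite !dg_coord //; congr (_ * _).
  by rewrite -{1}[h i]sqr_sqrtr ?(ltW (h0 i)) // -/(d i); field.
- by split.
- move=> x; apply: (dg_intertwine (d := h) (d' := h) _ _ _ Num.sqrt) => // y.
  by rewrite -HD HA.
- split=> //; last exact: unipotent_inv.
    exact: invertible_inv.
  by apply: inv_unique => x; exact: invertibleVK.
apply/lfunP => x; rewrite /kk /T !comp_lfunE.
by rewrite invertibleK // invertibleVK.
Qed.

End BlockPolar.

(** * Minimality along orbits *)

(** Equality case of Chebyshev's sum inequality: the hypothesis makes the double sum of the
    nonnegative [t i j] vanish. It states that the log of the sum of the squares of
    [expR (r * be i) * y i] has equal derivatives at r = 0 and r = 1. *)
Lemma chebyshev_eq (R : realType) (I : finType) (be y : I -> R) :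
  (\sum_i y i ^+ 2) * (\sum_i be i * (expR (be i) * y i) ^+ 2) =
  (\sum_i (expR (be i) * y i) ^+ 2) * (\sum_i be i * y i ^+ 2) ->
  forall i j, y i != 0 -> y j != 0 -> be i = be j.
Proof.
move=> h; pose e i := expR (be i) ^+ 2.
pose t i j := (be i - be j) * (e i - e j) * (y i ^+ 2 * y j ^+ 2).
have e_mono i j : be i < be j -> e i < e j.
  by move=> ij; rewrite /e -!expRM_natl ltr_expR ltr_pM2l.
have t0 i j : 0 <= t i j.
  rewrite /t mulr_ge0 //; last by rewrite mulr_ge0 ?sqr_ge0.
  case: (ltgtP (be i) (be j)) => [ij|ij|->]; last by rewrite subrr mul0r.
    by rewrite mulr_le0 // subr_le0 ltW // e_mono.
  by rewrite mulr_ge0 // subr_ge0 ltW // e_mono.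
have prodE (u v : I -> R) : (\sum_i u i) * (\sum_j v j) = \sum_i \sum_j u i * v j.
  by rewrite mulr_suml; apply: eq_bigr => i _; rewrite mulr_sumr.
have sum0 : \sum_i \sum_j t i j = 0.
  transitivity ((\sum_i be i * (expR (be i) * y i) ^+ 2) * (\sum_i y i ^+ 2)
     + (\sum_i y i ^+ 2) * (\sum_i be i * (expR (be i) * y i) ^+ 2)
     - (\sum_i be i * y i ^+ 2) * (\sum_i (expR (be i) * y i) ^+ 2)
     - (\sum_i (expR (be i) * y i) ^+ 2) * (\sum_i be i * y i ^+ 2)).
    rewrite !prodE -big_split -!sumrB; apply: eq_bigr => i _ /=.
    rewrite -big_split -!sumrB; apply: eq_bigr => j _ /=.
    by rewrite /t /e !exprMn; ring.
  move: h; set s1 := \sum_i y i ^+ 2; set s2 := \sum_i be i * (_ * _) ^+ 2.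
  by set s3 := \sum_i (_ * _) ^+ 2; set s4 := \sum_i be i * _ => h; lra.
move=> i j yi yj.
have tij : t i j = 0.
  have /eqP := sum0; rewrite psumr_eq0 => [/allP /(_ i (mem_index_enum i))|l _]; last first.
    by apply: sumr_ge0 => m _; exact: t0.
  by rewrite /= psumr_eq0 // => /allP /(_ j (mem_index_enum j)) /eqP.
move: tij => /eqP; rewrite !mulf_eq0 (negbTE yi) (negbTE yj) !orbF !subr_eq0.
case/orP => /eqP // eij.
by case: (ltgtP (be i) (be j)) => // /e_mono; rewrite eij ltxx.
Qed.

Lemma vline_scale (R : realType) (V : vectType R) (c : R) (v : V) : c != 0 ->
  <[c *: v]>%VS = <[v]>%VS.
Proof.
move=> c0; apply/eqP; rewrite eqEsubv -!memvE; apply/andP; split.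
  by rewrite memvZ // memv_line.
have {1}-> : v = c^-1 *: (c *: v) by rewrite scalerA mulVf // scale1r.
by rewrite memvZ // memv_line.
Qed.

(** * Weights of a bracket under the parabolic subgroup *)

Section WeightFiltration.
Variables (R : realType) (E : vectType R) (ip : {dot E for idfun}).
Notation Hip := (ip_inner ip).
Variables (k : nat) (f : 'I_k -> E).
Hypothesis Hf : onb ip f.
Implicit Types (mu : bilin E) (a : 'I_k -> R).

Lemma coord3_act g mu I : coord3 ip f (act g mu) I =
  \sum_(L : 'I_k * 'I_k * 'I_k) ip ((g^-1)%VF (f I.1.1)) (f L.1.1) *
    ip ((g^-1)%VF (f I.1.2)) (f L.1.2) * ip (g (f L.2)) (f I.2) * coord3 ip f mu L.
Proof.
rewrite /coord3 actE (innerC Hip) -(adjE g _ _ Hf) (innerC Hip) (ip_coord3 Hf).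
by apply: eq_bigr => L _; rewrite adjE // (innerC Hip (f I.2)).
Qed.

Definition block_upper a (h : 'End(E)) : Prop :=
  forall i j, ip (h (f j)) (f i) != 0 -> a j <= a i.

Lemma act_weight_ge a g mu (c : R) :
  block_upper a g -> block_upper a (g^-1)%VF ->
  (forall I, coord3 ip f mu I != 0 -> c <= weight a I) ->
  forall I, coord3 ip f (act g mu) I != 0 -> c <= weight a I.
Proof.
move=> ug ug' hmu I; apply: contraNT; rewrite -ltNge => hI.
rewrite coord3_act big1 // => L _; apply/eqP/negPn/negP.
rewrite !mulf_eq0 !negb_or -!andbA => /and4P[/ug' h1 /ug' h2 /ug h3 /hmu h4].
by move: hI; rewrite ltNge => /negP; apply; move: h4; rewrite /weight; lra.
Qed.

Lemma unipotent_upper a u : unipotent ip f a u -> block_upper a u.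
Proof.
move=> uu i j; apply: contraNT; rewrite -ltNge => aij.
rewrite uu ?ltW //; case: (eqVneq i j) => // ij.
by move: aij; rewrite ij ltxx.
Qed.

(** Commuting maps are block diagonal, hence upper for both orders; the order of [- a] turns
    [act_weight_ge] into an upper bound on weights. *)
Lemma commute_upper a (h : 'End(E)) : (forall x, dg ip f a (h x) = h (dg ip f a x)) ->
  block_upper a h /\ block_upper (fun i => - a i) h.
Proof.
move=> ch; have aij i j : ip (h (f j)) (f i) != 0 -> a i = a j.
  have := congr1 (fun x => ip x (f i)) (ch (f j)).
  rewrite /= dg_coord // dg_onb // linearZ /= (innerZl Hip) => /eqP.
  rewrite -subr_eq0 -mulrBl mulf_eq0 subr_eq0 => /orP[/eqP //|/eqP ->].
  by rewrite eqxx.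
by split=> i j /aij ->.
Qed.

Lemma coord3_act_unipotent a w mu (c : R) :
  unipotent ip f a w -> unipotent ip f a (w^-1)%VF ->
  (forall I, coord3 ip f mu I != 0 -> weight a I = c) ->
  forall I, weight a I <= c -> coord3 ip f (act w mu) I = coord3 ip f mu I.
Proof.
move=> uw uu hmu I hI; rewrite coord3_act (bigD1 I) //= big1 => [|L LI].
  by rewrite !uw // !uu // !eqxx !mul1r addr0.
apply/eqP/negPn/negP; rewrite !mulf_eq0 !negb_or -!andbA => /and4P[n1 n2 n3 /hmu hL].
have h1 := unipotent_upper uu n1; have h2 := unipotent_upper uu n2.
have h3 := unipotent_upper uw n3.
move: hI hL; rewrite /weight => hI hL.
(* All three changes raise the weight and the total change is not positive, so the three comparisons
   are equalities, where [w] and its inverse are the identity. *)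
have e1 : a L.1.1 <= a I.1.1 by lra.
have e2 : a L.1.2 <= a I.1.2 by lra.
have e3 : a I.2 <= a L.2 by lra.
move: n1 n2 n3; rewrite uu // uu // uw //.
move: LI; case: I {hI hL e1 e2 e3 h1 h2 h3} => -[i j] l; case: L => -[i' j'] l' /=.
case: (eqVneq i' i) => [->|]; last by rewrite eqxx.
case: (eqVneq j' j) => [->|]; last by rewrite eqxx.
by case: (eqVneq l l') => [->|]; rewrite eqxx.
Qed.

End WeightFiltration.

(** * Comparison of F along an orbit, with its equality case *)

Section Orbit.
Variables (R : realType) (E : vectType R) (ip : {dot E for idfun}).
Notation Hip := (ip_inner ip).
Variables (n : nat) (e : n.-tuple E).
Hypothesis he : orthonormal_basis ip e.
Variables (gamma : tensors E) (s : bool) (Js : seq 'End(E)).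
Hypothesis HJ : forall J, J \in Js -> compatible_structure ip J.
Hypothesis HG : forall phi, invertible phi -> (fixes phi gamma <-> preserves ip s Js phi).

Notation Hhs := (hs_inner he).
Notation Rg := (Ric_ ip e gamma).
Notation F := (F_ ip e gamma).
Notation sqn mu := (ip_bilin ip e mu mu).
Notation N := (moment_sqr ip e gamma).
Notation Hproj := (Ric_projP he HJ HG).

Section Isometry.
Variable kk : 'End(E).
Hypotheses (ki : invertible kk) (ko : orthogonal_map ip kk) (kp : preserves ip s Js kk).

Lemma onb_isometry k (f : 'I_k -> E) : onb ip f -> onb ip (kk \o f).
Proof.
move=> [of_ fs]; split=> [i j|x]; first by rewrite /= ko of_.
rewrite -{1}[x](invertibleVK x ki) {1}[(kk^-1)%VF x]fs linear_sum.
apply: eq_bigr => i _; rewrite linearZ /=; congr (_ *: _).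
by rewrite -[in RHS](invertibleVK x ki) ko.
Qed.

Lemma dg_isometry k (f : 'I_k -> E) a x : onb ip f ->
  dg ip (kk \o f) a (kk x) = kk (dg ip f a x).
Proof.
move=> Hf; apply: (onb_ext (onb_isometry Hf)) => i.
by rewrite (dg_coord (onb_isometry Hf)) /= !ko dg_coord.
Qed.

Lemma p_alg_isometry k (f : 'I_k -> E) a : onb ip f ->
  p_alg ip s Js (dg ip f a) -> p_alg ip s Js (dg ip (kk \o f) a).
Proof.
move=> Hf [_ AJ]; split=> [X Y|J JJ X]; first exact: dg_sym.
have kJ Y : kk (J Y) = J (kk Y).
  have := kp JJ; case: ifP => _ h; last exact: h.
  apply: (inner_ext Hip) => Z; rewrite -[Z](invertibleVK Z ki) ko.
  by rewrite (innerC Hip) -h (innerC Hip).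
by rewrite -[X](invertibleVK X ki) -kJ !dg_isometry // AJ // linearZ /= kJ.
Qed.

Lemma coord3_isometry k (f : 'I_k -> E) (mu : bilin E) I :
  coord3 ip (kk \o f) (act kk mu) I = coord3 ip f mu I.
Proof. by rewrite /coord3 actE /= !invertibleK // ko. Qed.

Lemma hs_isometry k (f : 'I_k -> E) a k' (f' : 'I_k' -> E) b :
  onb ip f -> onb ip f' ->
  hs ip e (dg ip (kk \o f) a) (dg ip (kk \o f') b) = hs ip e (dg ip f a) (dg ip f' b).
Proof.
move=> Hf Hf'; rewrite (hs_onb he _ _ (onb_isometry Hf)) (hs_onb he _ _ Hf).
by apply: eq_bigr => i _; rewrite /= !dg_isometry // ko.
Qed.

End Isometry.

Variables (k : nat) (f : 'I_k -> E) (a : 'I_k -> R) (mu : bilin E) (c : R).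
Hypotheses (Hf : onb ip f) (smu : skew_bilin mu) (mu0 : mu != 0).
Hypothesis Ra : Rg mu = dg ip f a.
Hypothesis Ha : moment_eigen ip f a mu c.

Lemma orbit_min g : G_ gamma g ->
  F <[mu]>%VS <= F <[act g mu]>%VS /\
  (F <[act g mu]>%VS = F <[mu]>%VS ->
   exists2 kk, K_ ip gamma kk & <[act g mu]>%VS = <[act kk mu]>%VS).
Proof.
move=> /(GP HG)[gi gp].
have [pR hR] := Hproj mu; rewrite Ra in pR hR.
have [kk [u [w [l [f' [d [[ki kp ko] [Hf' d0 Sp] SA [wi wu uu uw] gE]]]]]]] :=
  block_polar HJ Hf gi gp pR.
set S := dg ip f' d in Sp SA gE.
have d0' i : d i != 0 by rewrite gt_eqF.
have Si : invertible S by exact: dg_invertible.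
have SiA x : dg ip f a ((S^-1)%VF x) = (S^-1)%VF (dg ip f a x).
  by rewrite -{2}[x](invertibleVK x Si) SA invertibleK.
pose nu := act w mu; pose sg := act S nu.
have gmu : act g mu = act kk sg.
  by rewrite gE !act_act //; exact: invertible_comp.
have sgmu : skew_bilin (act g mu) by exact: act_skew.
have gmu0 : act g mu != 0 by exact: act_neq0.
have supp I : coord3 ip f mu I != 0 -> weight a I = c.
  by move=> x0; apply: (mulIf x0); exact: Ha.
have sg_ge I : coord3 ip f sg I != 0 -> c <= weight a I.
  move: I; apply: (act_weight_ge Hf).
  - exact: (commute_upper Hf SA).1.
  - exact: (commute_upper Hf SiA).1.
  apply: (act_weight_ge Hf); [exact: unipotent_upper|by rewrite wu; exact: unipotent_upper|].
  by move=> I /supp ->.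
have Hkf := onb_isometry ki ko Hf.
(* Conjugation of A by [kk], written as the same eigenvalues on the rotated basis; this operator
   tests the moment map at [act g mu]. *)
pose A' := dg ip (kk \o f) a.
have pA' : p_alg ip s Js A' by exact: p_alg_isometry.
have [pR' hR'] := Hproj (act g mu).
set q := sqn mu; set q' := sqn (act g mu).
have q0 : 0 < q by exact: sqn_gt0.
have q'0 : 0 < q' by exact: sqn_gt0.
have q'E : q' = \sum_I coord3 ip f sg I ^+ 2.
  rewrite /q' (sqnE he _ Hkf) gmu; apply: eq_bigr => I _.
  by rewrite coord3_isometry.
have NE : 4 * N mu = c * q by exact: (moment_eigen_value he HJ HG Hf smu Ra Ha).
have N0 nu' : 0 <= N nu' by exact: (inner_ge0 Hhs).
pose P := hs ip e (Rg (act g mu)) A'.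
have PE : 4 * P = \sum_I weight a I * coord3 ip f sg I ^+ 2.
  rewrite /P hR' // /A' (hs_Ric_dg he) // gmu; apply: eq_bigr => I _.
  by rewrite coord3_isometry.
have P_ge : c * q' <= 4 * P.
  rewrite PE q'E mulr_sumr; apply: ler_sum => I _.
  have [->|/sg_ge h] := eqVneq (coord3 ip f sg I) 0; first by rewrite expr0n !mulr0.
  by rewrite ler_wpM2r // sqr_ge0.
have AA : hs ip e A' A' = N mu by rewrite /A' hs_isometry // -Ra.
have CS : P ^+ 2 <= N (act g mu) * N mu by rewrite -AA; exact: (cauchy_schwarz Hhs).
(* Allows squaring [c * q' <= 4 * P]. *)
have c0 : 0 <= c.
  by rewrite -(pmulr_lge0 _ q0) -NE mulr_ge0.
have cE : c = 4 * N mu / q by rewrite NE mulfK // gt_eqF.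
(* Cauchy-Schwarz leaves one factor [N mu] to cancel, hence the separate case where it is zero. *)
have key : N mu * q' ^+ 2 <= N (act g mu) * q ^+ 2.
  have [->|Nn0] := eqVneq (N mu) 0; first by rewrite mul0r mulr_ge0 // sqr_ge0.
  have Np : 0 < N mu by rewrite lt_neqAle eq_sym Nn0 N0.
  rewrite -(ler_pM2l Np).
  have h1 : (c * q') ^+ 2 <= (4 * P) ^+ 2.
    by rewrite ler_sqr ?nnegrE // ?(le_trans _ P_ge) // mulr_ge0 // ltW.
  have h2 : (c * q') ^+ 2 * q ^+ 2 <= (4 * P) ^+ 2 * q ^+ 2.
    by rewrite ler_wpM2r // sqr_ge0.
  have h3 : (4 * P) ^+ 2 * q ^+ 2 <= 16 * (N (act g mu) * N mu) * q ^+ 2.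
    by rewrite ler_wpM2r ?sqr_ge0 // exprMn -natrX ler_pM2l.
  have h4 : (c * q') ^+ 2 * q ^+ 2 = 16 * (N mu * (N mu * q' ^+ 2)).
    rewrite exprMn mulrAC -exprMn -NE; ring.
  have := le_trans h2 h3; rewrite h4; nra.
rewrite !(F_line he HJ HG) -/q -/q'; split.
  by rewrite ler_pdivrMr ?exprn_gt0 // mulrAC ler_pdivlMr ?exprn_gt0 // key.
have [qn0 q'n0] : q != 0 /\ q' != 0 by rewrite !gt_eqF.
move=> /eqP; rewrite eqr_div ?expf_neq0 // => /eqP Feq.
(* Equal values of F turn Cauchy-Schwarz into the reverse of [P_ge], which will force every weight
   occurring in [sg] to be [c]. *)
have P_le : 4 * P <= c * q'.
  have cq0 : 0 <= c * q' by rewrite mulr_ge0 // ltW.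
  have [|P0] := leP (4 * P) 0; first by move=> h; exact: le_trans h cq0.
  rewrite -ler_sqr ?nnegrE ?(ltW P0) // -(ler_pM2r (exprn_gt0 2 q0)).
  have -> : (c * q') ^+ 2 * q ^+ 2 = 16 * (N mu * (N mu * q' ^+ 2)).
    by rewrite exprMn mulrAC -exprMn -NE; ring.
  rewrite -Feq; have := ler_wpM2r (sqr_ge0 q) CS; lra.
have PE' : 4 * P = c * q' by apply/eqP; rewrite eq_le P_le P_ge.
have sg_eq I : coord3 ip f sg I != 0 -> weight a I = c.
  have pos L : true -> 0 <= (weight a L - c) * coord3 ip f sg L ^+ 2.
    move=> _; have [->|/sg_ge h] := eqVneq (coord3 ip f sg L) 0.
      by rewrite expr0n mulr0.
    by rewrite mulr_ge0 ?sqr_ge0 // subr_ge0.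
  have /eqP : \sum_I (weight a I - c) * coord3 ip f sg I ^+ 2 = 0.
    under eq_bigr do rewrite mulrBl.
    by rewrite sumrB -PE PE' -mulr_sumr -q'E subrr.
  rewrite psumr_eq0 // => /allP /(_ I (mem_index_enum I)) /=.
  by rewrite mulf_eq0 sqrf_eq0 subr_eq0 => /orP[/eqP //|->].
(* Undoing [S], which preserves weights, shows that [nu] has no weight above [c]; at weights up to
   [c] the unipotent [w] leaves the coordinates of [mu] unchanged. *)
have nuE : nu = mu.
  have nu_le I : coord3 ip f nu I != 0 -> weight a I <= c.
    have wN L : weight (fun i => - a i) L = - weight a L by rewrite /weight; ring.
    have -> : nu = act (S^-1)%VF sg by rewrite act_invK.
    have SS : ((S^-1)^-1 = S)%VF by apply: inv_unique => x; exact: invertibleVK.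
    move=> /(@act_weight_ge _ _ _ _ _ Hf (fun i => - a i) _ _ (- c)) h.
    rewrite -lerN2 -wN; apply: h.
    - exact: (commute_upper Hf SiA).2.
    - by rewrite SS; exact: (commute_upper Hf SA).2.
    - by move=> L /sg_eq; rewrite wN => ->.
  apply: (coord3_ext Hf) => I; have [wc|wc] := leP (weight a I) c.
    by apply: (coord3_act_unipotent Hf uw) wc => //; rewrite wu.
  have -> : coord3 ip f nu I = 0.
    by apply/eqP/negPn/negP => /nu_le; rewrite leNgt wc.
  by apply/esym/eqP/negPn/negP => /supp wI; rewrite wI ltxx in wc.
have sgE : sg = act S mu by rewrite /sg nuE.
(* Ratio of the norms of the two operators forced by equality of F; equality in Cauchy-Schwarz then
   makes them proportional. *)
pose t := q' / q.
have Rt : Rg (act g mu) = t *: A'.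
  apply/eqP; rewrite -subr_eq0; apply/eqP/(inner_eq0 Hhs).
  rewrite !(innerBl Hhs) !(innerBr Hhs) !(innerZl Hhs) !(innerZr Hhs) AA.
  rewrite (innerC Hhs A') -/P -/(N (act g mu)) /t.
  have -> : N (act g mu) = N mu * q' ^+ 2 / q ^+ 2.
    by rewrite -Feq mulfK // expf_neq0 // gt_eqF.
  have -> : P = N mu * q' / q.
    apply: (mulfI (x := 4)); first by rewrite pnatr_eq0.
    by rewrite PE' cE; field; rewrite gt_eqF.
  by field; rewrite gt_eqF.
pose b i := ln (d i).
have pB : p_alg ip s Js (dg ip f' b) by exact: p_alg_dg_ln.
have Hkf' := onb_isometry ki ko Hf'.
have pB' := p_alg_isometry ki ko kp Hf' pB.
pose y := coord3 ip f' mu.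
have sgy I : coord3 ip f' sg I = expR (weight b I) * y I.
  rewrite sgE coord3_act_dg // /weight !expRD !expRN /b !lnK ?posrE //.
have q'y : q' = \sum_I (expR (weight b I) * y I) ^+ 2.
  rewrite /q' (sqnE he _ Hkf') gmu; apply: eq_bigr => I _.
  by rewrite coord3_isometry // sgy.
have qy : q = \sum_I y I ^+ 2 by rewrite /q (sqnE he _ Hf').
(* Both operators paired here are conjugates by [kk], so the pairing reduces to one at [mu]; this is
   the hypothesis of [chebyshev_eq]. *)
have RB' : \sum_I weight b I * (expR (weight b I) * y I) ^+ 2 =
    t * \sum_I weight b I * y I ^+ 2.
  transitivity (4 * hs ip e (Ric ip e (act g mu)) (dg ip (kk \o f') b)).
    rewrite (hs_Ric_dg he) // gmu; apply: eq_bigr => I _.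
    by rewrite coord3_isometry // sgy.
  rewrite -hR' // Rt (innerZl Hhs) /A' hs_isometry // hR // mulrCA.
  by rewrite (hs_Ric_dg he).
have cheb : forall I L, y I != 0 -> y L != 0 -> weight b I = weight b L.
  apply: chebyshev_eq; rewrite RB' -q'y -qy /t.
  by field; rewrite gt_eqF.
have [I0 yI0] : exists I, y I != 0.
  case: (pickP (fun I => y I != 0)) => [I yI|y0]; first by exists I.
  have := q0; rewrite qy big1 ?ltxx // => I _.
  by have /negbT := y0 I; rewrite negbK => /eqP ->; rewrite expr0n.
exists kk; first by split=> //; apply/(GP HG).
have -> : act g mu = expR (weight b I0) *: act kk mu.
  rewrite gmu; have -> : sg = expR (weight b I0) *: mu.
    apply: (coord3_ext Hf') => I; rewrite coord3_scale sgy -/(y I).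
    have [->|yI] := eqVneq (y I) 0; first by rewrite !mulr0.
    by rewrite (cheb I I0).
  apply/lfunP => X; apply/lfunP => Y.
  by rewrite !(scale_lfunE, actE) linearZ.
by rewrite vline_scale // gt_eqF // expR_gt0.
Qed.

End Orbit.

Theorem theorem4p3 (R : realType) (n : nat) (E : vectType R)
    (ip : {dot E for idfun}) (e : n.-tuple E)
    (he : orthonormal_basis ip e)
    (gamma : tensors E) (hgamma : class_tensors gamma)
    (hcomp : compatible ip gamma)
    (mu : bilin E) (hmu : skew_bilin mu) (mu0 : mu != 0) :
  let F := F_ ip e gamma in
  [/\ critical_point F mu <->
        (forall g, G_ gamma g -> F <[mu]>%VS <= F <[act g mu]>%VS),
      critical_point F mu <->
        (exists (c : R) (D : 'End(E)),
           is_derivation mu D /\ Ric_ ip e gamma mu = c *: \1%VF + D) &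
      critical_point F mu ->
        forall g, G_ gamma g -> critical_point F (act g mu) ->
          exists2 k, K_ ip gamma k & <[act g mu]>%VS = <[act k mu]>%VS].
Proof.
have [s [Js [HJ HG]]] := structure_of_tensors hgamma hcomp.
have eigenbasis nu : exists k (f : 'I_k -> E) (a : 'I_k -> R),
    onb ip f /\ Ric_ ip e gamma nu = dg ip f a.
  have [[Rs _] _] := Ric_projP he HJ HG nu.
  have [k [f [a [Hf Af]]]] := symmetric_onb (ip_inner ip) Rs.
  by exists k, f, a; split=> //; exact: dg_unique.
have [k [f [a [Hf Ra]]]] := eigenbasis mu.
have crit := critical_eigen he HJ HG Hf hmu mu0 Ra.
move=> F; split.
- split=> [/crit[c Ha] g Gg|hmin].
    exact: (orbit_min he HJ HG Hf hmu mu0 Ra Ha Gg).1.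
  by apply/crit/(orbit_min_eigen he HJ HG Hf hmu mu0 Ra).
  apply: (iff_trans crit); apply: iff_sym.
  exact: (derivation_eigen Hf Ra).
move=> /crit[c Ha] g Gg critg.
have [gi _] := Gg.
have [le_g eq_g] := orbit_min he HJ HG Hf hmu mu0 Ra Ha Gg.
(* [act g mu] is critical too, hence minimal on the orbit it shares with [mu]; its minimality, used
   with the inverse of [g], gives the opposite inequality. *)
apply: eq_g; apply/eqP; rewrite eq_le le_g andbT.
have smug := act_skew g hmu; have gmu0 := act_neq0 gi mu0.
have [k' [f' [a' [Hf' Ra']]]] := eigenbasis (act g mu).
have /(critical_eigen he HJ HG Hf' smug gmu0 Ra')[c' Ha'] := critg.
have := (orbit_min he HJ HG Hf' smug gmu0 Ra' Ha' (G_inv HG Gg)).1.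
by rewrite act_invK.
Qed.
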